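(* Let $d\ge2$ be an integer and let $f:(-1,1)\to\mathbb{R}$ satisfy the following assumptions. (a) $f\in C^\infty(-1,1)$. (b) There are real sequences $(A_i)_{i\ge0}$, $(B_i)_{i\ge0}$, $(\alpha_i)_{i\ge0}$, $(\beta_i)_{i\ge0}$ with $\frac{1-d}{2}<\alpha_0<\alpha_1<\dots$, $\lim_i\alpha_i=\infty$, $\frac{1-d}{2}<\beta_0<\beta_1<\dots$, $\lim_i\beta_i=\infty$, such that for every $m\ge0$ $$f(t)=\sum_{i=0}^m A_i(1+t)^{\alpha_i}+O\big((1+t)^{\alpha_{m+1}}\big)\ (t\searrow-1),\qquad f(t)=\sum_{i=0}^m B_i(1-t)^{\beta_i}+O\big((1-t)^{\beta_{m+1}}\big)\ (t\nearrow 1).$$ Moreover, if $A_j=0$ for some $j\ge0$ then $A_i=0$ for all $i\ge j$, and likewise for $(B_i)$. (c) For every $k\ge1$ the expansions may be differentiated term-wise $k$ times: for every $m\ge 0$, $$f^{(k)}(t)=\sum_{i=0}^m A_i\frac{\partial^k}{\partial t^k}(1+t)^{\alpha_i}+O\big((1+t)^{\alpha_{m+1}-k}\big)\ (t\searrow-1),\qquad f^{(k)}(t)=\sum_{i=0}^m B_i\frac{\partial^k}{\partial t^k}(1-t)^{\beta_i}+O\big((1-t)^{\beta_{m+1}-k}\big)\ (t\nearrow1).$$ Define $$\gamma_\alpha:=\min\{\alpha_i: i\ge0,\ \alpha_i\notin\mathbb{N}_0,\ A_i\ne0\},\quad \gamma_\beta:=\min\{\beta_i: i\ge0,\ \beta_i\notin\mathbb{N}_0,\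 B_i\neq0\},\quad \gamma:=\min\{\gamma_\alpha,\gamma_\beta\},$$ where a minimum over the empty set is $\infty$. Let $(b_n)_{n\ge0}$ be the Legendre coefficients (of dimension $d$) of $f$. Then: (i) If $\gamma=\infty$, then $(b_n)$ decays faster than any polynomial. (ii) If $\gamma_\alpha\ne\gamma_\beta$, then for some constant $c>0$ depending on $f$ and $d$, $|b_n|\sim c\,n^{-2\gamma-1}$ as $n\to\infty$. (iii) If $\gamma_\alpha=\gamma_\beta<\infty$, let $j_\alpha,j_\beta$ be the indices with $\alpha_{j_\alpha}=\gamma=\beta_{j_\beta}$. Then $$|b_{n_k}|\in o\big(n_k^{-2\gamma-1}\big)\ \text{ as } k\to\infty \text{ for any subsequence } (n_k) \text{ with } (-1)^{n_k}A_{j_\alpha}+B_{j_\beta}=0,$$ $$|b_{n_k}|\sim c\,n_k^{-2\gamma-1}\ \text{ as } k\to\infty \text{ for any subsequence } (n_k) \text{ with } (-1)^{n_k}A_{j_\alpha}+B_{j_\beta}\ne0.$$ The constant $c>0$ may depend on $f$ and $d$.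
   Context: $\mathbb{N}_0=\{0,1,2,\dots\}$; $x_n\sim y_n$ means $x_n/y_n\to1$. The Legendre polynomials of dimension $d$ are $P_n(t)=C_n^{(\lambda)}(t)/C_n^{(\lambda)}(1)$ with $C_n^{(\lambda)}$ the Gegenbauer polynomials and $\lambda=\frac d2-1$ (for $d=2$ by the limit $\lambda\to0$); equivalently, $(P_n)_{n\ge0}$ are the polynomials with $\deg P_n=n$, $P_n(1)=1$, orthogonal on $[-1,1]$ with respect to the weight $w(t)=(1-t^2)^{(d-3)/2}$. Set $N(d,n)=\frac{2n+d-2}{n}\binom{n+d-3}{n-1}$ for $n\ge1$, $N(d,0)=1$, and let $|\mathbb{S}_{d-1}|=2\pi^{d/2}/\Gamma(d/2)$ be the surface area of the unit sphere in $\mathbb{R}^d$ (so $|\mathbb{S}_0|=2$). The Legendre coefficients of $f$ are $$b_n=\frac{N(d,n)|\mathbb{S}_{d-2}|}{|\mathbb{S}_{d-1}|}\int_{-1}^1 f(t)P_n(t)(1-t^2)^{(d-3)/2}\,dt .$$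
   Formalization: In the second claim of (iii) the single constant c is replaced by two positive constants, one for even and one for odd n_k, chosen independently of the subsequence; with one c the claim fails for subsequences of mixed parity when |A_{j_α}| ≠ |B_{j_β}|. *)

(* Defs.v *)
From HB Require Import structures.
From mathcomp Require Export all_boot all_order all_algebra.
From mathcomp Require Export all_classical all_reals all_analysis.

Set Implicit Arguments.
Unset Strict Implicit.
Unset Printing Implicit Defensive.

Export Order.TTheory GRing.Theory Num.Theory.
Export numFieldNormedType.Exports.

Local Open Scope classical_set_scope.
Local Open Scope ring_scope.

Section LegendreCoefficients.
Context {R : realType}.
Implicit Types (d n k m : nat) (f : R -> R) (x t l : R).

(* Gegenbauer polynomials C_n^(l), by their three-term recurrence
   n C_n = 2 (n + l - 1) X C_(n-1) - (n + 2 l - 2) C_(n-2). *)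
Fixpoint gegenbauer l n : {poly R} :=
  match n with
  | 0 => 1
  | n1.+1 =>
    match n1 with
    | 0 => (2 * l) *: 'X
    | n2.+1 => n%:R^-1 *: ((2 * (n1%:R + l)) *: ('X * gegenbauer l n1)
                           - (n2%:R + 2 * l) *: gegenbauer l n2)
    end
  end.

(* For d = 2 the parameter is l = 0 and C_n^(0) = 0 for n >= 1, hence the
   limit along the punctured neighbourhood of 0. *)
Definition legendre d n t : R :=
  if d == 2%N then
    lim ((gegenbauer l n).[t] / (gegenbauer l n).[1] @[l --> 0^'])
  else let l := d%:R / 2 - 1 in (gegenbauer l n).[t] / (gegenbauer l n).[1].

Definition Gamma x : R :=
  \int[lebesgue_measure]_(t in `]0, +oo[) (t `^ (x - 1) * expR (- t)).

(* Surface area of the unit sphere of R^d, written |S_(d-1)| in the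
   literature; so |S_(d-2)| is [sphere_area d.-1]. *)
Definition sphere_area d : R := 2 * pi `^ (d%:R / 2) / Gamma (d%:R / 2).

(* The truncated subtractions are exact for d >= 2 and n >= 1. *)
Definition harmonic_dim d n : R :=
  if n == 0%N then 1
  else (2 * n + d - 2)%:R / n%:R * 'C(n + d - 3, n - 1)%:R.

Definition legendre_coef d f n : R :=
  harmonic_dim d n * sphere_area d.-1 / sphere_area d *
  \int[lebesgue_measure]_(t in `]-1, 1[)
    (f t * legendre d n t * (1 - t ^+ 2) `^ ((d%:R - 3) / 2)).

Definition smooth_on_interval f :=
  forall k t, t \in `]-1, 1[ -> derivable (derive1n k f) t 1.

Definition admissible_expansion d (A alpha : R^nat) :=
  [/\ (1 - d%:R) / 2 < alpha 0%N,
      forall i, alpha i < alpha i.+1,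
      alpha i @[i --> \oo] --> +oo
    & forall j, A j = 0 -> forall i, (j <= i)%N -> A i = 0].

Definition expansion_left f (A alpha : R^nat) := forall m,
  (fun t => f t - \sum_(i < m.+1) A i * (1 + t) `^ alpha i)
    =O_ ((-1)^'+) (fun t => (1 + t) `^ alpha m.+1).

Definition expansion_right f (B beta : R^nat) := forall m,
  (fun t => f t - \sum_(i < m.+1) B i * (1 - t) `^ beta i)
    =O_ (1^'-) (fun t => (1 - t) `^ beta m.+1).

Definition derived_expansion_left k f (A alpha : R^nat) := forall m,
  (fun t => derive1n k f t
            - \sum_(i < m.+1) A i * derive1n k (fun s => (1 + s) `^ alpha i) t)
    =O_ ((-1)^'+) (fun t => (1 + t) `^ (alpha m.+1 - k%:R)).

Definition derived_expansion_right k f (B beta : R^nat) := forall m,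
  (fun t => derive1n k f t
            - \sum_(i < m.+1) B i * derive1n k (fun s => (1 - s) `^ beta i) t)
    =O_ (1^'-) (fun t => (1 - t) `^ (beta m.+1 - k%:R)).

(* The minimum is taken as an infimum in the extended reals, so that it is
   +oo on the empty set; see [sing_exponent_attained]. *)
Definition sing_exponent (A alpha : R^nat) : \bar R :=
  ereal_inf [set (alpha i)%:E | i in
               [set i | alpha i \isn't a Num.nat /\ A i != 0]].

Definition asymp_equiv (x y : R^nat) := x n / y n @[n --> \oo] --> (1 : R).

Lemma sing_exponent_attained d (A alpha : R^nat) :
  admissible_expansion d A alpha ->
  (exists i, alpha i \isn't a Num.nat /\ A i != 0) ->
  exists i, [/\ alpha i \isn't a Num.nat, A i != 0,
    sing_exponent A alpha = (alpha i)%:E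
    & forall j, alpha j \isn't a Num.nat -> A j != 0 -> alpha i <= alpha j].
Proof.
move=> [_ incr _ _] ex.
have mono : {homo alpha : i j / (i <= j)%N >-> i <= j}.
  by apply: homo_leq => //; [exact: le_trans | move=> i; exact/ltW].
have exb : exists i, (alpha i \isn't a Num.nat) && (A i != 0).
  by case: ex => i [h1 h2]; exists i; rewrite h1 h2.
case: (ex_minnP exb) => i /andP[hi Ai] imin.
have le_i j : alpha j \isn't a Num.nat -> A j != 0 -> alpha i <= alpha j.
  by move=> hj Aj; apply/mono/imin; rewrite hj Aj.
exists i; split=> //; apply/eqP; rewrite eq_le; apply/andP; split.
  by apply: ereal_inf_lbound; exists i.
by apply: le_ereal_inf_tmp => _ [j [hj Aj] <-]; rewrite lee_fin le_i.
Qed.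

End LegendreCoefficients.

(* Main.v *)
Require Import Defs.
From mathcomp Require Import all_boot all_order all_algebra.
From mathcomp Require Import all_classical all_reals all_analysis.
From mathcomp Require Import measurable_realfun.
From mathcomp Require Import ring lra.
Import Order.TTheory GRing.Theory Num.Theory.
Import numFieldNormedType.Exports.
Set Implicit Arguments.
Unset Strict Implicit.
Unset Printing Implicit Defensive.
Local Open Scope classical_set_scope.
Local Open Scope ring_scope.

(** The coefficient [b_n] is, up to explicit factors, the moment
    [M_n(f) = \int f P_n w] on ]-1, 1[ for the weight
    [w(t) = (1 - t ^+ 2) `^ (l - 1/2)], [l = d/2 - 1], where [P_n] is the
    normalised Gegenbauer polynomial. Three facts give its asymptotics.

    The moments of a pure power are explicit. With [s = 1] or [s = -1] and
    [u = 1 - s t], the moment of [u `^ b] is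
    [s ^+ n J(b) \prod_(j < n) (j - b) / (j + b + 2 l + 1)], [J(b) > 0]
    ([power_momentE]). Since [t = s (1 - u)], the three-term recurrence of the
    [P_n] expresses the moment of order [n + 2] of [u `^ b] through lower
    moments of [u `^ b] and [u `^ (b + 1)], and one integration by parts
    relates [J(b + 1)] to [J(b)]; induction on [n] over all [b] at once does
    the rest. The product vanishes for large [n] when [b] is a natural
    number, and otherwise behaves like [K n `^ (- 2 b - 2 l - 1)] with
    [K != 0] ([moment_ratio_cvg]), because the logarithms of its consecutive
    corrected ratios are [O(1 / n ^+ 2)].

    The moments of a smooth function decay fast ([moment_decay]). The [P_n]
    are eigenfunctions of a second order differential operator, symmetric for
    [w], with eigenvalues [- n (n + 2 l)]; each integration by parts gains a
    factor [n ^- 2], and [|P_n| <= 1] on [-1, 1] bounds what is left.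

    Finally, [f] minus sufficiently many terms of both its expansions has
    bounded derivatives up to any prescribed order on ]-1, 1[
    ([remainder_bounded_smooth]). This uses the expansions of the derivatives
    at each end point, together with the fact that the powers subtracted at
    one end point are smooth at the other.

    Hence [n `^ (2 g + 1) b_n - E ((-1) ^+ n a + b)] tends to 0
    ([legendre_coef_asymp]), where [E != 0] and where [a], [b] are the
    coefficients of [(1 + t) `^ g] and [(1 - t) `^ g] in the expansions, as
    soon as [g] is not a natural number and does not exceed the non-natural
    exponents that occur. The three cases of the theorem are read off from this limit. *)

(** * Integrals on an increasing union of segments *)

Section Exhaustion.
Context {R : realType}.
Notation mu := (@lebesgue_measure R).
Variables (u v : nat -> R).
Hypothesis uv : forall n, u n < v n.
Hypothesis ndE : forall n m, (n <= m)%N -> u m <= u n /\ v n <= v m.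
Let E n : set R := `[u n, v n]%classic.
Let D : set R := \bigcup_n E n.

Lemma segments_nd : nondecreasing_seq E.
Proof.
move=> n m nm; have [h1 h2] := ndE nm.
by apply/subsetPset => x; rewrite /E /= !in_itv/= => /andP[a b];
  rewrite (le_trans h1 a) (le_trans b h2).
Qed.

Lemma exhaust_measurable : measurable (D : set (measurableTypeR R)).
Proof. by apply: bigcup_measurable => n _; exact: measurable_itv. Qed.

Lemma exhaust_within (h : R -> R) n :
  {in D, continuous h} -> {within E n, continuous h}.
Proof.
move=> ch; apply: continuous_in_subspaceT => x; rewrite inE => Ex.
by apply: ch; rewrite inE; exists n.
Qed.

Lemma exhaust_measurable_fun (h : R -> R) :
  {in D, continuous h} -> measurable_fun D h.
Proof.
move=> ch; apply/measurable_fun_bigcup => [n|n]; first exact: measurable_itv.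
by apply: subspace_continuous_measurable_fun; [exact: measurable_itv|exact: exhaust_within].
Qed.

Lemma exhaust_FTC (h G : R -> R) n : {in D, continuous h} ->
  {in D, forall x : R, is_derive x 1 G (h x)} ->
  (\int[mu]_(x in E n) (h x)%:E = (G (v n) - G (u n))%:E)%E.
Proof.
move=> ch dG; rewrite EFinB; apply: continuous_FTC2 => //.
- exact: exhaust_within.
- have cG x : x \in E n -> {for x, continuous G}.
    rewrite inE => Ex; have /dG d : x \in D by rewrite inE; exists n.
    by apply: differentiable_continuous; apply/derivable1_diffP.
  split.
  + move=> x xE; have /dG // : x \in D.
    rewrite inE; exists n => //; rewrite /E /= in_itv/=.
    by move: xE; rewrite in_itv/= => /andP[/ltW -> /ltW ->].
  + apply: cvg_at_right_filter; apply: cG.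
    by rewrite inE /E /= in_itv/= lexx ltW.
  + apply: cvg_at_left_filter; apply: cG.
    by rewrite inE /E /= in_itv/= lexx ltW.
- move=> x xE; have /dG d : x \in D.
    rewrite inE; exists n => //; rewrite /E /= in_itv/=.
    by move: xE; rewrite in_itv/= => /andP[/ltW -> /ltW ->].
  by rewrite derive1E derive_val.
Qed.

(** A nonnegative function with a bounded primitive has bounded integrals on
    the segments, hence a finite integral on their union by monotone
    convergence. *)
Lemma exhaust_integrable (h G : R -> R) (M : R) : {in D, continuous h} ->
  {in D, forall x : R, 0 <= h x} ->
  {in D, forall x : R, is_derive x 1 G (h x)} ->
  {in D, forall x : R, `|G x| <= M} ->
  mu.-integrable D (EFin \o h).
Proof.
move=> ch h0 dG GM; apply/integrableP; split.
  by apply/measurable_EFinP; exact: exhaust_measurable_fun.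
have -> : (\int[mu]_(x in D) `|(EFin \o h) x| = \int[mu]_(x in D) (h x)%:E)%E.
  by apply: eq_integral => x xD /=; rewrite ger0_norm// h0.
apply: (@le_lt_trans _ _ (M + M)%:E); last by rewrite ltry.
have mh : measurable_fun D (fun x => (h x)%:E).
  by apply/measurable_EFinP; exact: exhaust_measurable_fun.
have cv := @ge0_nondecreasing_set_cvg_integral _ (measurableTypeR R) R E (fun x => (h x)%:E) mu
  segments_nd (fun n => measurable_itv _).
have {}cv := cv (fun i => measurable_funS exhaust_measurable (@bigcup_sup _ _ i setT E I) mh).
apply: (cvge_to_le (cv _)).
  move=> n x Ex; rewrite lee_fin h0// inE; by exists n.
apply: nearW => n; rewrite (exhaust_FTC n ch dG) lee_fin.
have Gm x : E n x -> `|G x| <= M by move=> Ex; apply: GM; rewrite inE; exists n.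
have [uE vE] : E n (u n) /\ E n (v n) by rewrite /E /= !in_itv/= !lexx ltW.
by move: (Gm _ uE) (Gm _ vE);
  rewrite !ler_norml => /andP[? ?] /andP[? ?]; lra.
Qed.

Lemma exhaust_cvg (h : R -> R) : mu.-integrable D (EFin \o h) ->
  \int[mu]_(x in E n) h x @[n --> \oo] --> \int[mu]_(x in D) h x.
Proof.
move=> ih; have mh := measurable_int _ ih.
have subED n : E n `<=` D by exact: bigcup_sup.
have ihE n : mu.-integrable (E n) (EFin \o h).
  apply: (@integrableS _ (measurableTypeR R) R mu D _ _ _ _ (subED n) ih).
    exact: exhaust_measurable.
  exact: measurable_itv.
have nE n : (\int[mu]_(x in E n) (h x)%:E = \int[mu]_(x in D) ((EFin \o h) \_ (E n)) x)%E.
  by rewrite -integral_mkcondr setIidr.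
apply: fine_cvg; rewrite fineK; last first.
  by apply: integrable_fin_num => //; exact: exhaust_measurable.
under eq_cvg do rewrite nE.
have [|||_ _] := @dominated_convergence _ (measurableTypeR R) R mu D exhaust_measurable
  (fun n => (EFin \o h) \_ (E n)) (EFin \o h) (abse \o (EFin \o h))
  _ mh _ (integrable_abse ih) _.
- move=> n.
  apply/(@measurable_restrict _ _ (measurableTypeR R) _ _ _ _ (measurable_itv _)).
    exact: exhaust_measurable.
  by apply: (@measurable_funS _ _ (measurableTypeR R) _ _ _ _ exhaust_measurable _ mh); exact: subIsetl.
- apply: aeW => x [N _ Nx]; apply: cvg_near_cst; exists N => // n /= Nn.
  rewrite patchE mem_set//; have /subsetPset := segments_nd Nn; exact.
- apply: aeW => x n _; rewrite patchE; case: ifPn => // _.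
  by rewrite abse0 abse_ge0.
- by [].
Qed.

Lemma exhaust_gt0 (h : R -> R) : mu.-integrable D (EFin \o h) ->
  (forall x, D x -> 0 < h x) -> 0 < \int[mu]_(x in D) h x.
Proof.
move=> ih h0; have mh := measurable_int _ ih.
rewrite lt_neqAle; apply/andP; split; last first.
  by apply: Rintegral_ge0 => x Dx; exact/ltW/h0.
apply/eqP => i0.
have fD : (\int[mu]_(x in D) (EFin \o h) x)%E \is a fin_num.
  by apply: integrable_fin_num => //; exact: exhaust_measurable.
have : (\int[mu]_(x in D) `|(EFin \o h) x| = 0)%E.
  have -> : (\int[mu]_(x in D) `|(EFin \o h) x| = \int[mu]_(x in D) (EFin \o h) x)%E.
    by apply: eq_integral => x; rewrite inE => Dx /=; rewrite ger0_norm// ltW// h0.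
  by rewrite -(fineK fD); congr EFin; rewrite i0.
have mD := exhaust_measurable.
move/(@ae_eq_integral_abs _ (measurableTypeR R) R mu D mD _ mh) => [N [mN N0 DN]].
have DsN : D `<=` N by move=> x Dx; apply: DN => /= /(_ Dx) [] /eqP; rewrite gt_eqF// h0.
have : (mu (E 0%N) <= mu N)%E.
  apply: le_measure; rewrite ?inE//; first exact: measurable_itv.
  by apply: subset_trans DsN; exact: bigcup_sup.
rewrite N0 lebesgue_measure_itv/= lte_fin uv -EFinD lee_fin subr_le0 leNgt uv.
by [].
Qed.

End Exhaustion.

(** * Integrals on ]-1, 1[ of functions with power growth at the end points *)

Section OpenInterval.
Context {R : realType}.
Notation mu := (@lebesgue_measure R).
Implicit Types (h G : R -> R) (a e t : R).

Let cut n : R := 1 - n.+2%:R^-1.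

Let cut_gt0 n : 0 < cut n.
Proof. by rewrite /cut subr_gt0 invf_lt1 ?ltr1n. Qed.

Let cut_lt1 n : cut n < 1.
Proof. by rewrite /cut ltrBlDr ltrDl invr_gt0. Qed.

Let cut_nd n m : (n <= m)%N -> - cut m <= - cut n /\ cut n <= cut m.
Proof.
move=> nm; have h : cut n <= cut m.
  by rewrite /cut lerD2l lerN2 lef_pV2 ?posrE ?ler_nat.
by rewrite lerN2.
Qed.

Let cut_lt n : - cut n < cut n.
Proof. by have := cut_gt0 n; lra. Qed.

Lemma itv_exhaust :
  `]-1, 1[%classic = \bigcup_n `[- cut n, cut n]%classic :> set R.
Proof.
apply/seteqP; split => t /=.
  rewrite in_itv/= => /andP[t1 t2].
  have d0 : 0 < 1 - `|t| by rewrite subr_gt0 ltr_norml t1 t2.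
  exists (Num.truncn (1 - `|t|)^-1) => //=.
  suff : `|t| <= cut (Num.truncn (1 - `|t|)^-1) by rewrite ler_norml in_itv.
  rewrite /cut lerBrDl -lerBrDr -[leRHS]invrK lef_pV2 ?posrE ?invr_gt0//.
  apply/ltW/(lt_trans (Num.Theory.truncnS_gt _)).
  by rewrite ltr_nat.
move=> [n _] /=; rewrite !in_itv/= => /andP[t1 t2].
by have := cut_lt1 n; rewrite (le_lt_trans t2)//= => c1; rewrite (lt_le_trans _ t1)// ltrN2.
Qed.

Let in_itv_exhaust t : (t \in \bigcup_n `[- cut n, cut n]%classic) = (-1 < t < 1).
Proof. by rewrite -itv_exhaust mem_setE in_itv. Qed.

Lemma subr_sqr_gt0 t : -1 < t < 1 -> 0 < 1 - t ^+ 2.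
Proof. by move=> /andP[? ?]; nra. Qed.

(** The admissible integrands: continuity inside, and at both end points a
    growth which is integrable when [-1 < a]. *)
Definition weight_bounded a h :=
  (forall t, -1 < t < 1 -> {for t, continuous h}) /\
  exists C, forall t, -1 < t < 1 -> `|h t| <= C * (1 - t ^+ 2) `^ a.

Let is_derive_affine (s t : R) : is_derive t 1 (fun x : R => 1 - s * x) (- s).
Proof. by apply: is_derive_eq; rewrite add0r mul1r -[_%:A]/(s * 1) mulr1. Qed.

(** Here and below the sign [s], given by [s ^+ 2 = 1], selects the end point
    [t = s] at which [1 - s * t] vanishes. *)
Lemma is_derive_powR_affine (s b t : R) : 0 < 1 - s * t ->
  is_derive t 1 (fun x : R => (1 - s * x) `^ b) (- s * b * (1 - s * t) `^ (b - 1)).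
Proof.
move=> h; have h1 := is_derive1_powR b h.
have := @is_derive1_comp _ (fun x => x `^ b) (fun x : R => 1 - s * x) _ _ _ h1 (is_derive_affine s t).
by move/is_derive_eq; apply; rewrite mulrC mulrA.
Qed.

Lemma affine_bounds (s t : R) : s ^+ 2 = 1 -> -1 < t < 1 -> 0 < 1 - s * t < 2.
Proof.
move=> /eqP; rewrite sqrf_eq1 => /orP[] /eqP -> /andP[? ?];
  by apply/andP; split; lra.
Qed.

Lemma powR_le_bound (x b : R) : 0 < x < 2 -> 0 <= b -> x `^ b <= 2 `^ b.
Proof.
move=> /andP[x0 x2] b0; apply: ge0_ler_powR => //; rewrite ?nnegrE; lra.
Qed.

Lemma derive_continuous (G h : R -> R) t :
  is_derive t (1 : R) G (h t) -> {for t, continuous G}.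
Proof. by move=> ?; apply: differentiable_continuous; apply/derivable1_diffP. Qed.

(** The primitive [- s (1 - s t) `^ (a + 1) / (a + 1)] is bounded for
    [-1 < a]. *)
Lemma affine_powR_integrable (s a : R) : s ^+ 2 = 1 -> -1 < a ->
  mu.-integrable `]-1, 1[ (fun t => ((1 - s * t) `^ a)%:E).
Proof.
move=> s1 a1; rewrite itv_exhaust.
have a10 : a + 1 != 0 by rewrite gt_eqF//; lra.
have s0 : s != 0 by apply/eqP => s0; move: s1; rewrite s0 expr0n/= => /eqP; rewrite eq_sym oner_eq0.
pose G t := - s / (a + 1) * (1 - s * t) `^ (a + 1).
apply: (@exhaust_integrable _ _ _ cut_lt cut_nd _ G (`|s / (a + 1)| * 2 `^ (a + 1))).
- move=> t; rewrite in_itv_exhaust => /(affine_bounds s1) /andP[t0 _].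
  by apply: (@derive_continuous _ (fun t => - s * a * (1 - s * t) `^ (a - 1)));
    exact: is_derive_powR_affine.
- by move=> t _; exact: powR_ge0.
- move=> t; rewrite in_itv_exhaust => /(affine_bounds s1) /andP[t0 _].
  have := is_derive_powR_affine (a + 1) t0.
  move=> /(@is_deriveZ _ _ _ _ (- s / (a + 1)))/is_derive_eq; apply.
  rewrite addrK -[_ *: _]/(_ * _).
  transitivity (s ^+ 2 * (1 - s * t) `^ a); last by rewrite s1 mul1r.
  by field.
- move=> t; rewrite in_itv_exhaust => /(affine_bounds s1) tb.
  rewrite /G normrM mulNr normrN ler_wpM2l// ger0_norm ?powR_ge0//.
  by apply: powR_le_bound => //; lra.
Qed.

Lemma sqr_factor s t : s ^+ 2 = 1 -> 1 - t ^+ 2 = (1 - s * t) * (1 + s * t).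
Proof. by move=> s1; rewrite mulrDr mulr1 mulrBl mul1r -expr2 exprMn s1; ring. Qed.

Lemma weight_split s t b : s ^+ 2 = 1 -> -1 < t < 1 ->
  (1 - t ^+ 2) `^ b = (1 - s * t) `^ b * (1 - - s * t) `^ b.
Proof.
move=> s1 tb; rewrite mulNr opprK (sqr_factor t s1) powRM//.
  by have /andP[/ltW] := affine_bounds s1 tb.
by have := @affine_bounds (- s) t; rewrite sqrrN mulNr opprK => /(_ s1 tb)/andP[/ltW].
Qed.

Lemma is_derive_weight b t : -1 < t < 1 ->
  is_derive t 1 (fun x : R => (1 - x ^+ 2) `^ b)
    (- 2 * b * t * (1 - t ^+ 2) `^ (b - 1)).
Proof.
move=> /subr_sqr_gt0 /(is_derive1_powR b) h1.
have h2 : is_derive t 1 (fun x : R => 1 - x ^+ 2) (- 2 * t).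
  by apply: is_derive_eq; rewrite -[_ *: _]/(_ * _) /=; ring.
have := @is_derive1_comp _ (fun x => x `^ b) (fun x : R => 1 - x ^+ 2) _ _ _ h1 h2.
by move/is_derive_eq; apply; ring.
Qed.

Lemma weight_continuous b t : -1 < t < 1 ->
  {for t, continuous (fun x : R => (1 - x ^+ 2) `^ b)}.
Proof.
by move/(is_derive_weight b)/(@derive_continuous _ (fun t => _ * t * _)); apply.
Qed.

(** For a negative exponent, one of the factors [1 - t] and [1 + t] is at least
    1, so that the product of powers is at most one of them; the last term
    covers the other exponents. *)
Lemma weight_le a t : -1 < t < 1 ->
  (1 - t ^+ 2) `^ a <= (1 - 1 * t) `^ a + (1 - -1 * t) `^ a + 1.
Proof.
move=> tb; have ? := powR_ge0 (1 - 1 * t) a; have ? := powR_ge0 (1 - -1 * t) a.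
have [a0|a0] := leP 0 a.
  suff : (1 - t ^+ 2) `^ a <= 1 by lra.
  apply: (@le_trans _ _ (1 `^ a)); last by rewrite powR1.
  have t2 := subr_sqr_gt0 tb.
  by apply: ge0_ler_powR; rewrite ?nnegrE//; have := sqr_ge0 t; lra.
rewrite (@weight_split 1) ?expr1n//.
have [t0|t0] := leP 0 t.
  suff : (1 - -1 * t) `^ a <= 1 by nra.
  by rewrite -[leRHS](powRr0 (1 - -1 * t)); apply: ler_powR; lra.
suff : (1 - 1 * t) `^ a <= 1 by nra.
by rewrite -[leRHS](powRr0 (1 - 1 * t)); apply: ler_powR; lra.
Qed.

Lemma weight_bounded_integrable a h : -1 < a -> weight_bounded a h ->
  mu.-integrable `]-1, 1[ (EFin \o h).
Proof.
move=> a1 [ch [C hC]].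
have mI : measurable (`]-1, 1[%classic : set (measurableTypeR R)) by exact: measurable_itv.
apply: (@le_integrable _ (measurableTypeR R) R mu _ mI _
  (EFin \o (fun t : R => `|C| * ((1 - 1 * t) `^ a + (1 - -1 * t) `^ a + 1)))).
- apply/measurable_EFinP; rewrite itv_exhaust; apply: exhaust_measurable_fun => t.
  by rewrite in_itv_exhaust; exact: ch.
- move=> t /=; rewrite in_itv/= => tb; rewrite lee_fin.
  have ? := powR_ge0 (1 - 1 * t) a; have ? := powR_ge0 (1 - -1 * t) a.
  have := powR_ge0 (1 - t ^+ 2) a; have := weight_le a tb.
  set x := (1 - t ^+ 2) `^ a; set y := _ + 1 => xy x0.
  apply: (le_trans (hC _ tb)); rewrite normrM normr_id (@ger0_norm _ y) ?(le_trans x0)//.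
  by apply: (le_trans (ler_wpM2r x0 (ler_norm C))); apply: ler_wpM2l.
apply: (@integrableZl _ (measurableTypeR R) R mu _ mI `|C|
  (EFin \o (fun t : R => (1 - 1 * t) `^ a + (1 - -1 * t) `^ a + 1))).
apply: (@integrableD _ (measurableTypeR R) R mu _ mI
  (EFin \o (fun t : R => (1 - 1 * t) `^ a + (1 - -1 * t) `^ a)) (EFin \o cst 1)).
  apply: (@integrableD _ (measurableTypeR R) R mu _ mI
  (EFin \o (fun t : R => (1 - 1 * t) `^ a)) (EFin \o (fun t : R => (1 - -1 * t) `^ a))).
    by apply: affine_powR_integrable; rewrite ?expr1n.
  by apply: affine_powR_integrable; rewrite ?sqrrN ?expr1n.
have -> : EFin \o cst 1 = (fun t : R => ((1 - 1 * t) `^ 0)%:E).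
  by apply/funext => t /=; rewrite powRr0.
by apply: affine_powR_integrable; rewrite ?expr1n ?ltrN10.
Qed.

Let cut_cvg1 : cut n @[n --> \oo] --> (1 : R).
Proof.
rewrite -[X in _ --> X](subr0 1); apply: cvgB; first exact: cvg_cst.
have := @cvg_harmonic R; rewrite -(cvg_shiftS (@harmonic R)).
by apply: cvg_trans; apply: near_eq_cvg; near=> n.
Unshelve. all: end_near. Qed.

(** The fundamental theorem of calculus for a primitive which vanishes at both
    end points: every integration by parts below has this form. *)
Lemma weight_bounded_FTC a e h G C : -1 < a -> weight_bounded a h -> 0 < e ->
  (forall t, -1 < t < 1 -> is_derive t 1 G (h t)) ->
  (forall t, -1 < t < 1 -> `|G t| <= C * (1 - t ^+ 2) `^ e) ->
  \int[mu]_(t in `]-1, 1[) h t = 0.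
Proof.
move=> a1 hb e0 dG GC.
have := weight_bounded_integrable a1 hb; rewrite {1}itv_exhaust.
move=> /(exhaust_cvg cut_nd); rewrite -itv_exhaust => cv.
apply: (cvg_unique _ cv) => //.
have cutb n : -1 < cut n < 1 /\ -1 < - cut n < 1.
  by have := cut_lt1 n; have := cut_gt0 n => ? ?; split; apply/andP; split; lra.
have cvq : (1 - cut n ^+ 2) `^ e @[n --> \oo] --> (0 : R).
  have /cvg_at_rightP := @powR_cvg0 R e e0; apply; split.
    by move=> n; apply: subr_sqr_gt0; case: (cutb n).
  rewrite -[X in _ --> X](_ : 1 - 1 ^+ 2 = 0 :> R); last by rewrite expr1n subrr.
  apply: cvgB; first exact: cvg_cst.
  by rewrite expr2; apply: cvg_trans (cvgM cut_cvg1 cut_cvg1) => //; apply: near_eq_cvg; near=> n; rewrite expr2.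
have cvC : C * (1 - cut n ^+ 2) `^ e *+ 2 @[n --> \oo] --> (0 : R).
  rewrite -[X in _ --> X](_ : C * 0 *+ 2 = 0 :> R); last by rewrite mulr0 mul0rn.
  by apply: cvgMn; apply: cvgMr.
apply/cvgr0Pnorm_le => eps eps0; near=> n.
rewrite /Rintegral (@exhaust_FTC _ _ _ cut_lt h G n) /=; last 2 first.
- by move=> t; rewrite in_itv_exhaust; case: hb => + _; apply.
- by move=> t; rewrite in_itv_exhaust; exact: dG.
have [b1 b2] := cutb n.
apply: (le_trans (ler_normB _ _)); apply: (@le_trans _ _ (C * (1 - cut n ^+ 2) `^ e *+ 2)).
  by rewrite mulr2n lerD// ?GC// -(sqrrN (cut n)) GC.
apply: (le_trans (ler_norm _)).
by near: n; move/cvgr0Pnorm_le : cvC; apply.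
Unshelve. all: end_near. Qed.

Lemma integral_opp a h : -1 < a -> weight_bounded a h ->
  \int[mu]_(t in `]-1, 1[) h (- t) = \int[mu]_(t in `]-1, 1[) h t.
Proof.
move=> a1 hb.
have hbN : weight_bounded a (fun t => h (- t)).
  have bN t : -1 < t < 1 -> -1 < - t < 1 by move=> /andP[? ?]; apply/andP; split; lra.
  case: hb => ch [C hC]; split => [t tb|].
    by apply: continuous_comp; [exact: opp_continuous|exact/ch/bN].
  by exists C => t tb; rewrite -(sqrrN t); exact/hC/bN.
have := weight_bounded_integrable a1 hbN; rewrite {1}itv_exhaust.
move=> /(exhaust_cvg cut_nd); rewrite -itv_exhaust => cvN.
have := weight_bounded_integrable a1 hb; rewrite {1}itv_exhaust.
move=> /(exhaust_cvg cut_nd); rewrite -itv_exhaust => cv.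
apply: (cvg_unique _ cvN) => //; apply: cvg_trans cv; apply: near_eq_cvg; near=> n.
rewrite /Rintegral; congr fine.
have := @integration_by_substitution_oppr R h (- cut n) (cut n).
rewrite opprK; apply; first exact/ltW/cut_lt.
apply: continuous_in_subspaceT => t; rewrite inE/= in_itv/= => /andP[t1 t2].
by case: hb => + _; apply; have := cut_lt1 n => c1; apply/andP; split; lra.
Unshelve. all: end_near. Qed.

Lemma weight_bounded_gt0 a h : -1 < a -> weight_bounded a h ->
  (forall t, -1 < t < 1 -> 0 < h t) -> 0 < \int[mu]_(t in `]-1, 1[) h t.
Proof.
move=> a1 /(weight_bounded_integrable a1) ih h0; rewrite itv_exhaust.
by apply: exhaust_gt0; rewrite -?itv_exhaust.
Qed.

End OpenInterval.

(** * Closure properties of the class of integrands *)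

Section WeightBoundedClosure.
Context {R : realType}.
Implicit Types (f g : R -> R) (a b s t : R).

Lemma weight_boundedD a f g : weight_bounded a f -> weight_bounded a g ->
  weight_bounded a (fun t => f t + g t).
Proof.
move=> [cf [C hC]] [cg [D hD]]; split=> [t tb|].
  by apply: cvgD; [exact: cf|exact: cg].
exists (C + D) => t tb; apply: (le_trans (ler_normD _ _)).
by rewrite mulrDl lerD ?hC ?hD.
Qed.

Lemma weight_boundedZ a (k : R) f : weight_bounded a f ->
  weight_bounded a (fun t => k * f t).
Proof.
move=> [cf [C hC]]; split=> [t tb|]; first by apply: cvgMr; exact: cf.
by exists (`|k| * C) => t tb; rewrite normrM -mulrA ler_wpM2l ?hC.
Qed.

Lemma weight_boundedW a b f : a <= b -> weight_bounded b f -> weight_bounded a f.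
Proof.
move=> ab [cf [C hC]]; split=> //; exists `|C| => t tb.
apply: (le_trans (hC _ tb)).
apply: (le_trans (ler_wpM2r (powR_ge0 _ _) (ler_norm C))); apply: ler_wpM2l => //.
apply: ger_powR => //.
by rewrite subr_sqr_gt0//= gerBl sqr_ge0.
Qed.

Lemma weight_bounded0P f : (forall t, -1 < t < 1 -> {for t, continuous f}) ->
  (exists C, forall t, -1 < t < 1 -> `|f t| <= C) -> weight_bounded 0 f.
Proof.
by move=> cf [C hC]; split=> //; exists C => t tb; rewrite powRr0 mulr1 hC.
Qed.

Lemma weight_bounded0_bound f : weight_bounded 0 f ->
  exists2 C, 0 <= C & forall t, -1 < t < 1 -> `|f t| <= C.
Proof.
move=> [_ [C hC]]; exists `|C| => // t tb.
by apply: (le_trans (hC t tb)); rewrite powRr0 mulr1 ler_norm.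
Qed.

Lemma weight_boundedM f g : weight_bounded 0 f -> weight_bounded 0 g ->
  weight_bounded 0 (fun t => f t * g t).
Proof.
move=> hf hg; have [C C0 hC] := weight_bounded0_bound hf.
have [D D0 hD] := weight_bounded0_bound hg.
apply: weight_bounded0P => [t tb|]; first by apply: cvgM; [exact: (proj1 hf)|exact: (proj1 hg)].
by exists (C * D) => t tb; rewrite normrM ler_pM ?hC ?hD.
Qed.

(** For a negative exponent the blow-up at one end point is charged to
    [1 - t ^+ 2], the other factor of which stays below 2; for a positive one
    the function is bounded. *)
Lemma weight_bounded_powR s b : s ^+ 2 = 1 ->
  weight_bounded (Num.min b 0) (fun t => (1 - s * t) `^ b).
Proof.
move=> s1; split=> [t tb|].
  have /andP[t0 _] := affine_bounds s1 tb.
  by apply: (@derive_continuous _ _ (fun t => - s * b * (1 - s * t) `^ (b - 1)));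
    exact: is_derive_powR_affine.
exists (2 `^ `|b|) => t tb; rewrite ger0_norm ?powR_ge0//.
have tb1 := affine_bounds s1 tb; have /andP[t1 _] := tb1.
have [b0|b0] := leP b 0; last first.
  by rewrite powRr0 mulr1 gtr0_norm//; apply: powR_le_bound => //; exact: ltW.
rewrite (weight_split b s1 tb) mulrCA ler_peMr ?powR_ge0// ler0_norm//.
have := @affine_bounds _ (- s) t; rewrite sqrrN => /(_ s1 tb) tb2.
have /andP[t2 _] := tb2.
rewrite -[X in _ * _ `^ X]opprK (powRN (1 - - s * t)) ler_pdivlMr ?powR_gt0// mul1r.
by apply: powR_le_bound => //; rewrite oppr_ge0.
Qed.

End WeightBoundedClosure.

(** * Positivity of the Gamma function *)

Section GammaPositive.
Context {R : realType}.
Notation mu := (@lebesgue_measure R).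
Implicit Types t x : R.

Let lo n : R := n.+2%:R^-1.
Let hi n : R := n.+2%:R.

Let lo_lt n : lo n < hi n.
Proof.
apply: (@lt_trans _ _ 1); rewrite /lo /hi ?ltr1n//.
by rewrite invf_lt1 ?ltr1n.
Qed.

Let lohi_nd n m : (n <= m)%N -> lo m <= lo n /\ hi n <= hi m.
Proof. by move=> nm; rewrite /lo /hi lef_pV2 ?posrE// !ler_nat. Qed.

Lemma halfline_exhaust :
  `]0, +oo[%classic = \bigcup_n `[lo n, hi n]%classic :> set R.
Proof.
apply/seteqP; split => t /=.
  rewrite in_itv/= andbT => t0.
  exists (maxn (Num.truncn t) (Num.truncn t^-1)) => //=.
  rewrite in_itv/=; apply/andP; split.
    rewrite /lo -[leRHS]invrK lef_pV2 ?posrE ?invr_gt0//.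
    apply/ltW/(lt_trans (Num.Theory.truncnS_gt _)).
    by rewrite ltr_nat !ltnS leq_maxr.
  apply/ltW/(lt_trans (Num.Theory.truncnS_gt _)).
  by rewrite ltr_nat !ltnS leq_maxl.
move=> [n _] /=; rewrite !in_itv/= andbT => /andP[t1 _].
by apply: lt_le_trans t1; rewrite /lo invr_gt0.
Qed.

Let in_halfline t : (t \in \bigcup_n `[lo n, hi n]%classic) = (0 < t).
Proof. by rewrite -halfline_exhaust mem_setE in_itv/= andbT. Qed.

(** The integrand of the beta function with parameters [x] and 1 has an
    elementary bounded primitive; it dominates that of the Gamma function. *)
Let is_derive_beta x t : 0 < x -> 0 < t ->
  is_derive t 1 (fun u : R => x^-1 * (u `^ x * (1 + u) `^ (- x)))
    (t `^ (x - 1) * (1 + t) `^ (- x - 1)).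
Proof.
move=> x0 t0; have t10 : 0 < 1 - -1 * t by lra.
have d1 := is_derive1_powR x t0.
have d2 : is_derive t 1 (fun u : R => (1 + u) `^ (- x)) (- x * (1 + t) `^ (- x - 1)).
  have := is_derive_powR_affine (- x) t10; rewrite opprK mul1r.
  have -> : (fun u : R => (1 - -1 * u) `^ (- x)) = (fun u => (1 + u) `^ (- x)).
    by apply/funext => u; rewrite mulN1r opprK.
  by rewrite mulN1r opprK.
apply: is_derive_eq; rewrite -![_ *: _]/(_ * _).
have -> : (1 + t) `^ (- x) = (1 + t) * (1 + t) `^ (- x - 1).
  have t1 : 1 + t != 0 by rewrite gt_eqF//; lra.
  by rewrite powRB ?t1 ?implybT// powRr1 1?mulrC ?divfK//; lra.
by rewrite -(mulr_powRB1 (ltW t0) x0); field; rewrite gt_eqF.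
Qed.

Let expR_le_powR x t : 0 < x -> 0 < t ->
  expR (- t) <= expR ((x + 1) * ln (x + 1)) * (1 + t) `^ (- x - 1).
Proof.
move=> x0 t0; rewrite /powR gt_eqF ?ltr_wpDl// -expRD ler_expR.
have x10 : 0 < x + 1 by lra.
have h0 : 0 < (1 + t) / (x + 1) by rewrite divr_gt0// ltr_wpDl.
have : ln ((1 + t) / (x + 1)) <= (1 + t) / (x + 1) - 1.
  by rewrite -{1}[_ / _](subrKC 1) le_ln1Dx//; lra.
have E : (x + 1) * ((1 + t) / (x + 1) - 1) = t - x by field; rewrite gt_eqF.
rewrite ln_div ?posrE//; last by lra.
move/(ler_wpM2l (ltW x10)); rewrite E => h; lra.
Qed.

Lemma Gamma_gt0 x : 0 < x -> 0 < Gamma x.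
Proof.
move=> x0; rewrite /Gamma halfline_exhaust.
have cpow (b c t : R) : 0 < t -> {for t, continuous (fun u : R => u `^ b)}.
  by move=> t0; have := is_derive1_powR b t0; exact: (@derive_continuous _ _ (fun t => b * t `^ (b - 1))).
have cpow1 (b t : R) : 0 < t -> {for t, continuous (fun u : R => (1 + u) `^ b)}.
  move=> t0; have t10 : 0 < 1 - -1 * t by lra.
  have := is_derive_powR_affine b t10.
  have -> : (fun x0 : R => (1 - -1 * x0) `^ b) = (fun x0 : R => (1 + x0) `^ b).
    by apply/funext => u; rewrite mulN1r opprK.
  exact: (@derive_continuous _ _ (fun t => - -1 * b * (1 - -1 * t) `^ (b - 1))).
apply: exhaust_gt0 => //; last first.
  move=> t; rewrite -halfline_exhaust/= in_itv/= andbT => t0.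
  by rewrite mulr_gt0 ?powR_gt0 ?expR_gt0.
pose g t := t `^ (x - 1) * (1 + t) `^ (- x - 1).
have ig : mu.-integrable (\bigcup_n `[lo n, hi n]%classic) (EFin \o g).
  apply: (@exhaust_integrable _ _ _ lo_lt lohi_nd _
    (fun u : R => x^-1 * (u `^ x * (1 + u) `^ (- x))) x^-1).
  - move=> t; rewrite in_halfline => t0; apply: cvgM; first exact: cpow.
    exact: cpow1.
  - by move=> t _; rewrite mulr_ge0// powR_ge0.
  - by move=> t; rewrite in_halfline => t0; exact: is_derive_beta.
  - move=> t; rewrite in_halfline => t0.
    rewrite ger0_norm ?mulr_ge0 ?invr_ge0 ?powR_ge0 ?(ltW x0)//.
    rewrite ler_piMr ?invr_ge0 ?(ltW x0)// powRN ler_pdivrMr ?powR_gt0 ?ltr_wpDl//.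
    rewrite mul1r; apply: ge0_ler_powR; rewrite ?nnegrE; lra.
have mD := @exhaust_measurable R lo hi.
apply: (@le_integrable _ (measurableTypeR R) R mu _ mD _
  (EFin \o (fun t : R => expR ((x + 1) * ln (x + 1)) * g t))).
- apply/measurable_EFinP; apply: exhaust_measurable_fun => t.
  rewrite in_halfline => t0; apply: cvgM; first exact: cpow.
  by apply: continuous_comp; [exact: opp_continuous|exact: continuous_expR].
- move=> t; rewrite -halfline_exhaust /= in_itv/= andbT => t0; rewrite lee_fin.
  rewrite !ger0_norm ?mulr_ge0 ?powR_ge0 ?expR_ge0//.
  by rewrite mulrCA ler_wpM2l ?powR_ge0// expR_le_powR.
- exact: (@integrableZl _ (measurableTypeR R) R mu _ mD _ (EFin \o g)).
Qed.

Lemma sphere_area_gt0 d : (0 < d)%N -> 0 < @sphere_area R d.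
Proof.
move=> d0; rewrite /sphere_area divr_gt0 ?mulr_gt0 ?powR_gt0 ?pi_gt0//.
by apply: Gamma_gt0; rewrite divr_gt0 ?ltr0n.
Qed.

End GammaPositive.

(** * Normalised Gegenbauer polynomials *)

Section LegendrePolynomials.
Context {R : realType}.
Implicit Types (l t : R) (n : nat).

(** The quotients [C_n / C_n(1)] of the Gegenbauer polynomials satisfy a
    recurrence which is regular at [l = 0]; taking it as the definition covers
    the case [d = 2] along with the others. *)
Fixpoint ultraspherical l n : {poly R} :=
  match n with
  | 0 => 1
  | n1.+1 =>
    match n1 with
    | 0 => 'X
    | n2.+1 => (n1%:R + 2 * l)^-1 *:
        ((2 * (n1%:R + l)) *: ('X * ultraspherical l n1)
         - n1%:R *: ultraspherical l n2)
    end
  end.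

Local Notation P := ultraspherical.
Local Notation "P ^'()" := (deriv P) (at level 1, format "P ^'()").

Lemma ultrasphericalSS l n : n.+1%:R + 2 * l != 0 ->
  (n.+1%:R + 2 * l) *: P l n.+2 =
  (2 * (n.+1%:R + l)) *: ('X * P l n.+1) - n.+1%:R *: P l n.
Proof. by move=> c0; rewrite [P l n.+2]/= scalerA divff// scale1r. Qed.

Section Fixed.
Variables (l : R) (l0 : - 2^-1 < l).

Let c_gt0 n : 0 < n.+1%:R + 2 * l.
Proof. have : 1 <= n.+1%:R :> R by rewrite ler1n.
by move: l0 => ? ?; lra. Qed.

Let c_neq0 n : n.+1%:R + 2 * l != 0. Proof. by rewrite gt_eqF. Qed.

Lemma ultraspherical_rec n t :
  (n.+1%:R + 2 * l) * (P l n.+2).[t] =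
  2 * (n.+1%:R + l) * (t * (P l n.+1).[t]) - n.+1%:R * (P l n).[t].
Proof.
by have := congr1 (fun p => p.[t]) (ultrasphericalSS (c_neq0 n));
  rewrite !hornerE.
Qed.

Let deriv_rec n t :
  (n.+1%:R + 2 * l) * (P l n.+2)^'().[t] =
  2 * (n.+1%:R + l) * ((P l n.+1).[t] + t * (P l n.+1)^'().[t])
  - n.+1%:R * (P l n)^'().[t].
Proof.
have := congr1 (fun p => p^'().[t]) (ultrasphericalSS (c_neq0 n)).
by rewrite !(derivZ, derivB, derivM, derivX) !hornerE.
Qed.

Let step_up n t :
  (1 - t ^+ 2) * (P l n.+1)^'().[t] =
    n.+1%:R * ((P l n).[t] - t * (P l n.+1).[t]) ->
  (1 - t ^+ 2) * (P l n.+1)^'().[t] =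
    (n.+1%:R + 2 * l) * (t * (P l n.+1).[t] - (P l n.+2).[t]).
Proof. by move->; rewrite [RHS]mulrBr ultraspherical_rec; ring. Qed.

(** Both structure relations go through the induction together: the second one
    at [n] and the first one at [n.+1] give the first one at [n.+2]. *)
Lemma ultraspherical_deriv n t :
  (1 - t ^+ 2) * (P l n.+1)^'().[t] =
    n.+1%:R * ((P l n).[t] - t * (P l n.+1).[t]) /\
  (1 - t ^+ 2) * (P l n)^'().[t] =
    (n%:R + 2 * l) * (t * (P l n).[t] - (P l n.+1).[t]).
Proof.
elim: n => [|n [A B]].
  by rewrite /= derivX derivC !hornerE; split; ring.
split; last exact: step_up.
apply: (mulfI (c_neq0 n)).
rewrite mulrCA deriv_rec.
have rec := ultraspherical_rec n t.
transitivity (2 * (n.+1%:R + l) * ((1 - t ^+ 2) * (P l n.+1).[t] + t * ((1 - t ^+ 2) * (P l n.+1)^'().[t]))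
  - n.+1%:R * ((1 - t ^+ 2) * (P l n)^'().[t])); first by ring.
rewrite A B [RHS]mulrCA [X in _ = _ * X]mulrBr (mulrCA _ t) rec.
ring.
Qed.

(** Differentiating the second structure relation and eliminating
    [P_(n+1)] with the first one gives the equation times [1 - t ^+ 2]. *)
Lemma ultraspherical_ode n t : -1 < t < 1 ->
  (1 - t ^+ 2) * (P l n)^'()^'().[t] =
  (2 * l + 1) * t * (P l n)^'().[t] - n%:R * (n%:R + 2 * l) * (P l n).[t].
Proof.
move=> tb; have t2 : 1 - t ^+ 2 != 0 by rewrite gt_eqF// subr_sqr_gt0.
have [A B] := ultraspherical_deriv n t.
have D : (1 - t ^+ 2) * (P l n)^'()^'().[t] - 2 * t * (P l n)^'().[t] =
  (n%:R + 2 * l) * ((P l n).[t] + t * (P l n)^'().[t] - (P l n.+1)^'().[t]).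
  have E : horner ((1 - 'X ^+ 2) * (P l n)^'()) =
           horner ((n%:R + 2 * l) *: ('X * P l n - P l n.+1)).
    by apply/funext => x; rewrite !hornerE (proj2 (ultraspherical_deriv n x)).
  have := congr1 (fun f : R -> R => (f^`())%classic t) E.
  rewrite -!derivE !(derivZ, derivB, derivM, derivX, derivXn, derivC) !hornerE /=.
  move=> h; rewrite -[RHS]h; ring.
apply: (mulfI t2).
have -> : (1 - t ^+ 2) * (P l n)^'()^'().[t] = 2 * t * (P l n)^'().[t] +
  (n%:R + 2 * l) * ((P l n).[t] + t * (P l n)^'().[t] - (P l n.+1)^'().[t]).
  by rewrite -D; ring.
transitivity (2 * t * ((1 - t ^+ 2) * (P l n)^'().[t]) + (n%:R + 2 * l) *
 ((1 - t ^+ 2) * (P l n).[t] + t * ((1 - t ^+ 2) * (P l n)^'().[t]) - (1 - t ^+ 2) * (P l n.+1)^'().[t])).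
  by ring.
transitivity ((2 * l + 1) * t * ((1 - t ^+ 2) * (P l n)^'().[t]) - n%:R * (n%:R + 2 * l) * ((1 - t ^+ 2) * (P l n).[t])); last by ring.
rewrite A B -natr1; ring.
Qed.

Lemma ultraspherical1 n : (P l n).[1] = 1.
Proof.
suff [] : (P l n).[1] = 1 /\ (P l n.+1).[1] = 1 by [].
elim: n => [|n [h1 h2]]; first by rewrite /= !hornerE.
split=> //; apply: (mulfI (c_neq0 n)).
by rewrite ultraspherical_rec h1 h2; ring.
Qed.

Lemma ultrasphericalN1 n : (P l n).[-1] = (-1) ^+ n.
Proof.
suff [] : (P l n).[-1] = (-1) ^+ n /\ (P l n.+1).[-1] = (-1) ^+ n.+1 by [].
elim: n => [|n [h1 h2]]; first by rewrite /= !hornerE expr0 expr1.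
split=> //; apply: (mulfI (c_neq0 n)).
by rewrite ultraspherical_rec h1 h2 !exprS; ring.
Qed.

Lemma gegenbauerE n : l != 0 ->
  gegenbauer l n = (\prod_(j < n) ((j%:R + 2 * l) / j.+1%:R)) *: P l n.
Proof.
move=> ln0.
suff [] : gegenbauer l n = (\prod_(j < n) ((j%:R + 2 * l) / j.+1%:R)) *: P l n /\
  gegenbauer l n.+1 = (\prod_(j < n.+1) ((j%:R + 2 * l) / j.+1%:R)) *: P l n.+1 by [].
elim: n => [|n [h1 h2]].
  by rewrite /= big_ord_recr !big_ord0 /= scale1r mul1r add0r divr1.
split => //.
have -> : gegenbauer l n.+2 = n.+2%:R^-1 *: ((2 * (n.+1%:R + l)) *: ('X * gegenbauer l n.+1)
                           - (n%:R + 2 * l) *: gegenbauer l n) by [].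
rewrite h1 h2 big_ord_recr /= [in RHS]big_ord_recr /= -[in RHS]scalerA.
rewrite [_ / n.+2%:R]mulrC -(scalerA _ _ (P l n.+2)) ultrasphericalSS//.
rewrite big_ord_recr /= -scalerAr !scalerBr !scalerA.
set q := \prod_(i < n) _.
have : n.+1%:R != 0 :> R /\ n.+2%:R != 0 :> R by rewrite !pnatr_eq0.
move: (n.+1%:R : R) (n.+2%:R : R) => a b [a0 b0].
by congr (_ *: _ - _ *: _); field; rewrite ?a0 ?b0.
Qed.

(** Sonin's argument: [S = nu P ^+ 2 + (1 - t ^+ 2) P' ^+ 2], with
    [nu = n (n + 2 l)], has derivative [4 l t P' ^+ 2] by the differential
    equation. So [S] is maximal at the end points, where it equals [nu]. *)
Lemma ultraspherical_bounded n t : 0 <= l -> -1 <= t <= 1 -> `|(P l n).[t]| <= 1.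
Proof.
move=> lge0 /andP[tm tp].
case: n => [|n]; first by rewrite /= hornerC normr1.
set p := P l n.+1; pose nu : R := n.+1%:R * (n.+1%:R + 2 * l).
have nu0 : 0 < nu by rewrite mulr_gt0.
pose S : {poly R} := nu *: p ^+ 2 + (1 - 'X ^+ 2) * p^'() ^+ 2.
have dS x : -1 < x < 1 -> S^'().[x] = 4 * l * x * p^'().[x] ^+ 2.
  move=> xb; have ode := ultraspherical_ode n.+1 xb.
  rewrite /S !expr2 !(derivD, derivZ, derivN, derivM, derivX, derivC) !hornerE /=.
  transitivity (2 * p^'().[x] * (nu * p.[x] + (1 - x ^+ 2) * p^'()^'().[x] - x * p^'().[x])).
    by ring.
  by rewrite ode -/p /nu; ring.
have mvt a b : -1 <= a -> a < b -> b <= 1 ->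
    exists2 c, -1 < c < 1 /\ a < c < b & S.[b] - S.[a] = 4 * l * c * p^'().[c] ^+ 2 * (b - a).
  move=> am ab bp.
  have [c] := @MVT R (horner S) (horner S^'()) a b ab
    (fun x _ => is_derive_poly S x) (continuous_subspaceT (@continuous_horner R S)).
  rewrite in_itv/= => /andP[ac cb] E.
  have cb1 : -1 < c < 1 by apply/andP; split; lra.
  by exists c; rewrite ?ac ?cb// E dS.
have S1 : S.[1] = nu.
  by rewrite /S !expr2 !hornerE /= (ultraspherical1 n.+1 : p.[1] = 1); ring.
have SN1 : S.[-1] = nu.
  rewrite /S !expr2 !hornerE /=.
  transitivity (nu * p.[-1] ^+ 2); first by ring.
  by rewrite ultrasphericalN1 -exprM mulnC exprM sqrrN !expr1n mulr1.
have St : S.[t] <= nu.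
  have [t0|t0] := leP 0 t.
    have [->|t1] := eqVneq t 1; first by rewrite S1.
    have [//||//|c [_ /andP[c1 _]] E] := mvt t 1; first by rewrite lt_neqAle t1.
    have c0 := le_trans t0 (ltW c1).
    rewrite -subr_ge0 -S1 E; apply: mulr_ge0; last by rewrite subr_ge0.
    by apply: mulr_ge0; rewrite ?sqr_ge0 ?mulr_ge0.
  have [->|t1] := eqVneq t (-1); first by rewrite SN1.
  have [//||//|c [_ /andP[_ c1]] E] := mvt (-1) t; first by rewrite lt_neqAle eq_sym t1.
  have c0 : 0 <= - c by rewrite oppr_ge0 ltW// (lt_trans c1).
  have : 0 <= 4 * l * (- c) * p^'().[c] ^+ 2 * (t - -1).
    apply: mulr_ge0; last by lra.
    by apply: mulr_ge0; rewrite ?sqr_ge0 ?mulr_ge0.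
  by rewrite mulrN !mulNr -E SN1; lra.
have : nu * p.[t] ^+ 2 <= nu * 1.
  have -> : nu * p.[t] ^+ 2 = S.[t] - (1 - t) * (1 + t) * p^'().[t] ^+ 2.
    by rewrite /S !expr2 !hornerE /=; ring.
  have : 0 <= (1 - t) * (1 + t) * p^'().[t] ^+ 2.
    by apply: mulr_ge0; rewrite ?sqr_ge0//; apply: mulr_ge0; lra.
  by move=> ?; lra.
by rewrite ler_pM2l// -real_normK ?num_real// expr_le1.
Qed.

End Fixed.

Lemma ultraspherical_cvg n t :
  (ultraspherical l n).[t] @[l --> (0 : R)] --> (ultraspherical 0 n).[t].
Proof.
suff [] : (ultraspherical l n).[t] @[l --> (0 : R)] --> (ultraspherical 0 n).[t] /\
  (ultraspherical l n.+1).[t] @[l --> (0 : R)] --> (ultraspherical 0 n.+1).[t] by [].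
elim: n => [|n [h1 h2]]; first by split; exact: cvg_cst.
split => //.
have E (l : R) : (ultraspherical l n.+2).[t] = (n.+1%:R + 2 * l)^-1 *
   (2 * (n.+1%:R + l) * (t * (ultraspherical l n.+1).[t]) - n.+1%:R * (ultraspherical l n).[t]).
  by rewrite [ultraspherical l n.+2]/= !hornerE.
rewrite E; under eq_cvg do rewrite E.
have cid : l @[l --> (0 : R)] --> (0 : R) by exact: cvg_id.
apply: cvgM.
  apply: cvgV; first by rewrite mulr0 addr0 pnatr_eq0.
  by apply: cvgD; [exact: cvg_cst|exact: cvgMr].
apply: cvgB; last exact: cvgMr.
apply: cvgM; last exact: cvgMr.
by apply: cvgMr; apply: cvgD => //; exact: cvg_cst.
Qed.

Lemma legendreE d n t : (2 <= d)%N ->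
  legendre d n t = (ultraspherical (d%:R / 2 - 1) n).[t].
Proof.
move=> d2; rewrite /legendre.
have ratio (l : R) : - 2^-1 < l -> l != 0 ->
    (gegenbauer l n).[t] / (gegenbauer l n).[1] = (ultraspherical l n).[t].
  move=> lm l0; rewrite gegenbauerE// !hornerE ultraspherical1// mulr1.
  (* the factor of index 0 is the one that vanishes when l = 0 *)
  rewrite mulrAC divff ?mul1r//; apply/prodf_neq0 => -[[|j] /= _] _; last first.
    rewrite mulf_neq0 ?invr_eq0 ?pnatr_eq0// gt_eqF//.
    have : 1 <= j.+1%:R :> R by rewrite ler1n.
    by move=> ?; lra.
  by rewrite add0r divr1 mulf_neq0 ?pnatr_eq0.
case: ifPn => [/eqP ->|d2'].
  rewrite divff ?pnatr_eq0// subrr; apply/cvg_lim => //.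
  apply: (@cvg_trans _ ((ultraspherical l n).[t] @[l --> (0 : R)^'])); last first.
    by apply: cvg_trans (@ultraspherical_cvg n t); apply: cvg_app; exact: cvg_within.
  apply: near_eq_cvg; near=> l; rewrite ratio//; last by near: l; exact: nbhs_dnbhs_neq.
  by near: l; apply: nbhs_dnbhs; apply: lt_nbhsr; rewrite oppr_lt0 invr_gt0.
have d3 : 3 <= d%:R :> R by rewrite (ler_nat _ 3) ltn_neqAle eq_sym d2'.
by rewrite /= ratio//; [lra|rewrite gt_eqF//; lra].
Unshelve. all: end_near. Qed.

End LegendrePolynomials.

(** * Moments of powers *)

Section Moments.
Context {R : realType}.
Notation mu := (@lebesgue_measure R).
Implicit Types (f g h : R -> R) (a b s t l : R) (n : nat).

Definition moment l f n : R := \int[mu]_(t in `]-1, 1[)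
  (f t * (ultraspherical l n).[t] * (1 - t ^+ 2) `^ (l - 2^-1)).

Section Fixed.
Variables (l : R) (l0 : 0 <= l).
Let lm : - 2^-1 < l. Proof. by have := l0; move=> ?; lra. Qed.
Local Notation P := (ultraspherical l).
Local Notation w t := ((1 - t ^+ 2) `^ (l - 2^-1)).

Lemma weight_bounded_moment b f n : weight_bounded b f ->
  weight_bounded (b + (l - 2^-1)) (fun t => f t * (P n).[t] * w t).
Proof.
move=> [cf [C hC]]; split=> [t tb|].
  apply: cvgM; last exact: weight_continuous.
  by apply: cvgM; [exact: cf|exact: continuous_horner].
exists C => t tb; rewrite !normrM (@powRD _ _ b); last first.
  by apply/implyP => _; rewrite gt_eqF// subr_sqr_gt0.
rewrite mulrA (@ger0_norm _ (w t)) ?powR_ge0// ler_wpM2r ?powR_ge0//.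
rewrite -[leRHS]mulr1 ler_pM ?hC// ultraspherical_bounded//.
by move: tb => /andP[? ?]; apply/andP; split; exact: ltW.
Qed.

Lemma moment_integrable b f n : - 2^-1 - l < b -> weight_bounded b f ->
  mu.-integrable `]-1, 1[ (EFin \o (fun t => f t * (P n).[t] * w t)).
Proof.
move=> bl /(weight_bounded_moment n); apply: weight_bounded_integrable.
by lra.
Qed.

Let mI : measurable (`]-1, 1[%classic : set (measurableTypeR R)).
Proof. exact: measurable_itv. Qed.

Lemma momentD b f g n : - 2^-1 - l < b -> weight_bounded b f -> weight_bounded b g ->
  moment l (fun t => f t + g t) n = moment l f n + moment l g n.
Proof.
move=> bl hf hg; rewrite /moment -(RintegralD mI); last 2 first.
- exact: moment_integrable bl hf.
- exact: moment_integrable bl hg.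
by apply: eq_Rintegral => t _; rewrite !mulrDl.
Qed.

Lemma momentZ b (k : R) f n : - 2^-1 - l < b -> weight_bounded b f ->
  moment l (fun t => k * f t) n = k * moment l f n.
Proof.
move=> bl hf; rewrite /moment -(RintegralZl k mI); last exact: moment_integrable bl hf.
by apply: eq_Rintegral => t _; rewrite !mulrA.
Qed.

Lemma eq_moment f g n : (forall t, -1 < t < 1 -> f t = g t) ->
  moment l f n = moment l g n.
Proof.
move=> fg; apply: eq_Rintegral => t; rewrite inE/= in_itv/= => tb.
by rewrite fg.
Qed.

Lemma moment_rec b f n : - 2^-1 - l < b -> weight_bounded b f ->
  weight_bounded b (fun t => t * f t) ->
  (n.+1%:R + 2 * l) * moment l f n.+2 =
  2 * (n.+1%:R + l) * moment l (fun t => t * f t) n.+1 - n.+1%:R * moment l f n.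
Proof.
move=> bl hf htf.
rewrite /moment -!(RintegralZl _ mI); try exact: moment_integrable bl _.
rewrite -(RintegralB mI); last 2 first.
- exact: (integrableZl mI _ (moment_integrable _ bl htf)).
- exact: (integrableZl mI _ (moment_integrable _ bl hf)).
apply: eq_Rintegral => t _.
have := ultraspherical_rec lm n t; set c := n.+1%:R; set x := (P n.+2).[t] => E.
transitivity (f t * w t * ((c + 2 * l) * x)); first by ring.
by rewrite E; ring.
Qed.

Definition power_moment s b n := moment l (fun t => (1 - s * t) `^ b) n.

Let min_gt b : - 2^-1 - l < b -> - 2^-1 - l < Num.min b 0.
Proof. by rewrite lt_min => ->; move: l0 => ?; apply: lt_le_trans (lexx _); lra. Qed.

Let powR_succ s b t : 0 < 1 - s * t -> (1 - s * t) `^ (b + 1) = (1 - s * t) * (1 - s * t) `^ b.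
Proof.
move=> t0; rewrite powRD; last by apply/implyP => _; rewrite gt_eqF.
by rewrite powRr1 ?(ltW t0)//; exact: mulrC.
Qed.

Let mul_var s b t : s ^+ 2 = 1 -> -1 < t < 1 ->
  t * (1 - s * t) `^ b = s * ((1 - s * t) `^ b + -1 * (1 - s * t) `^ (b + 1)).
Proof.
move=> s1 tb; have /andP[t0 _] := affine_bounds s1 tb.
rewrite powR_succ//; set x := _ `^ b.
by transitivity (s ^+ 2 * t * x); [rewrite s1; ring|ring].
Qed.

Let wb_succ s b : s ^+ 2 = 1 ->
  weight_bounded (Num.min b 0) (fun t => (1 - s * t) `^ (b + 1)).
Proof.
move=> s1; apply: weight_boundedW (weight_bounded_powR (b + 1) s1).
by rewrite le_min2 ?lexx// lerDl.
Qed.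

Let wb_var s b : s ^+ 2 = 1 ->
  weight_bounded (Num.min b 0) (fun t => s * ((1 - s * t) `^ b + -1 * (1 - s * t) `^ (b + 1))).
Proof.
by move=> s1; apply/weight_boundedZ/weight_boundedD; 
    [exact: weight_bounded_powR|exact/weight_boundedZ/wb_succ].
Qed.

Let moment_var s b n : s ^+ 2 = 1 -> - 2^-1 - l < b ->
  moment l (fun t => t * (1 - s * t) `^ b) n =
  s * (power_moment s b n - power_moment s (b + 1) n).
Proof.
move=> s1 bl; rewrite (eq_moment n (fun t => @mul_var s b t s1)).
have ? := min_gt bl.
have h1 := weight_bounded_powR b s1.
have h2 := weight_boundedZ (-1) (wb_succ b s1).
rewrite (momentZ (b := Num.min b 0))//; last exact: weight_boundedD.
rewrite (momentD (b := Num.min b 0))// (momentZ (b := Num.min (b + 1) 0)) ?mulN1r//.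
  by apply: min_gt; lra.
exact: weight_bounded_powR.
Qed.

Lemma power_moment_rec s b n : s ^+ 2 = 1 -> - 2^-1 - l < b ->
  (n.+1%:R + 2 * l) * power_moment s b n.+2 =
  2 * (n.+1%:R + l) * (s * (power_moment s b n.+1 - power_moment s (b + 1) n.+1))
  - n.+1%:R * power_moment s b n.
Proof.
move=> s1 bl; rewrite /power_moment (@moment_rec (Num.min b 0)).
- by rewrite moment_var.
- exact: min_gt.
- exact: weight_bounded_powR.
have [c [C hC]] := wb_var b s1; split=> [t tb|].
  by apply: cvgM; [exact: cvg_id|case: (weight_bounded_powR b s1) => + _; apply].
by exists C => t tb; rewrite (mul_var _ s1 tb) hC.
Qed.

Lemma power_moment1 s b : s ^+ 2 = 1 -> - 2^-1 - l < b ->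
  power_moment s b 1 = s * (power_moment s b 0 - power_moment s (b + 1) 0).
Proof.
move=> s1 bl; rewrite -moment_var//; apply: eq_Rintegral => t _ /=.
by rewrite hornerC hornerX mulr1 (mulrC t).
Qed.

(** The integral of the derivative of
    [(1 - s t) `^ b (1 - t ^+ 2) `^ (l + 1/2)], which vanishes at both end
    points. *)
Lemma power_moment0 s b : s ^+ 2 = 1 -> - 2^-1 - l < b ->
  (b + 2 * l + 1) * power_moment s (b + 1) 0 =
  (2 * b + 2 * l + 1) * power_moment s b 0.
Proof.
move=> s1 bl.
pose h t := s * ((b + 2 * l + 1) * (1 - s * t) `^ (b + 1) + - (2 * b + 2 * l + 1) * (1 - s * t) `^ b).
have bm := min_gt bl; have wp := weight_bounded_powR b s1.
have wp1 := wb_succ b s1.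
have w1 := weight_boundedZ (b + 2 * l + 1) wp1.
have w2 := weight_boundedZ (- (2 * b + 2 * l + 1)) wp.
have w12 := weight_boundedD w1 w2.
have hb : weight_bounded (Num.min b 0) h := weight_boundedZ s w12.
have h0 : moment l h 0 = 0.
  pose G t := (1 - s * t) `^ b * (1 - t ^+ 2) `^ (l + 2^-1).
  have [_ [C hC]] := wp.
  apply: (@weight_bounded_FTC _ (Num.min b 0 + (l - 2^-1)) (Num.min b 0 + (l + 2^-1)) _ G C).
  - by lra.
  - exact: weight_bounded_moment.
  - by lra.
  - move=> t tb; have /andP[t0 _] := affine_bounds s1 tb.
    have d1 := is_derive_powR_affine b t0.
    have d2 := is_derive_weight (l + 2^-1) tb.
    apply: is_derive_eq; rewrite -![_ *: _]/(_ * _) /h powR_succ// hornerC.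
    have -> : l + 2^-1 - 1 = l - 2^-1 by lra.
    have -> : (1 - t ^+ 2) `^ (l + 2^-1) = (1 - t ^+ 2) * (1 - t ^+ 2) `^ (l - 2^-1).
      have t2 := subr_sqr_gt0 tb.
      rewrite -[X in X * _](powRr1 (ltW t2)) -powRD; last first.
        by apply/implyP => _; rewrite gt_eqF.
      by congr (_ `^ _); lra.
    have -> : (1 - s * t) `^ b = (1 - s * t) * (1 - s * t) `^ (b - 1).
      by rewrite -[in LHS](subrK 1 b) powR_succ.
    move: (w t) ((1 - s * t) `^ (b - 1)) => W X; rewrite (sqr_factor t s1).
    (* both sides agree modulo s ^+ 2 = 1 only *)
    transitivity ((1 - s * t) * X * W *
      (- (2 * l + 1) * (s ^+ 2 * t) - b * s * (1 + s * t))); last by ring.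
    by rewrite s1; field.
  - move=> t tb; rewrite normrM (@ger0_norm _ (_ `^ (l + _))) ?powR_ge0//.
    rewrite (@powRD _ _ (Num.min b 0)); last first.
      by apply/implyP => _; rewrite gt_eqF// subr_sqr_gt0.
    by rewrite mulrA ler_wpM2r ?powR_ge0// hC.
have s0 : s != 0.
  by apply/eqP => s0; move: s1; rewrite s0 expr0n/= => /eqP; rewrite eq_sym oner_eq0.
move: h0; rewrite /h (momentZ s 0 bm w12) (momentD 0 bm w1 w2).
rewrite (momentZ _ 0 bm wp1) (momentZ _ 0 bm wp).
by move=> /eqP; rewrite mulf_eq0 (negbTE s0)/= mulNr subr_eq0 => /eqP.
Qed.

Definition moment_ratio b n : R :=
  \prod_(j < n) ((j%:R - b) / (j%:R + b + 2 * l + 1)).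

Lemma moment_ratioS b n : moment_ratio b n.+1 =
  moment_ratio b n * ((n%:R - b) / (n%:R + b + 2 * l + 1)).
Proof. by rewrite /moment_ratio big_ord_recr. Qed.

Lemma moment_ratio_shift b n : - 2^-1 - l < b ->
  moment_ratio (b + 1) n.+1 = moment_ratio b n *
    ((- b - 1) * (b + 2 * l + 1) / ((n%:R + b + 2 * l + 1) * (n.+1%:R + b + 2 * l + 1))).
Proof.
move=> bl; have pos (m : nat) : m%:R + b + 2 * l + 1 != 0.
  by rewrite gt_eqF//; have := ler0n R m; move: bl l0 => ? ? ?; lra.
elim: n => [|n IH].
  rewrite /moment_ratio big_ord1 big_ord0 /= mul1r !add0r.
  have := pos 1; have := pos 0; rewrite add0r => p0 p1; field.
  by apply/andP.
rewrite moment_ratioS IH moment_ratioS.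
have E1 : n.+1%:R = n%:R + 1 :> R by rewrite natr1.
have E2 : n.+2%:R = n%:R + 1 + 1 :> R by rewrite !natr1.
have := pos n; have := pos n.+1; have := pos n.+2; rewrite E2 E1 => p2 p1 p0.
by field; rewrite p0 p1 p2.
Qed.

(** The recurrence at [n.+2] calls the exponent [b + 1] at [n.+1], hence an
    induction for all exponents at once. *)
Lemma power_momentE s b n : s ^+ 2 = 1 -> - 2^-1 - l < b ->
  power_moment s b n = s ^+ n * power_moment s b 0 * moment_ratio b n.
Proof.
move=> s1.
suff H : forall b, - 2^-1 - l < b ->
  power_moment s b n = s ^+ n * power_moment s b 0 * moment_ratio b n /\
  power_moment s b n.+1 = s ^+ n.+1 * power_moment s b 0 * moment_ratio b n.+1.
  by move=> /H [].
have shift0 c : - 2^-1 - l < c -> power_moment s (c + 1) 0 =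
    (2 * c + 2 * l + 1) / (c + 2 * l + 1) * power_moment s c 0.
  move=> cl; have c0 : c + 2 * l + 1 != 0 by rewrite gt_eqF//; move: cl l0 => ? ?; lra.
  by apply: (mulfI c0); rewrite power_moment0//; field.
elim: n => [|n IH] {}b bl.
  split; first by rewrite /moment_ratio big_ord0 expr0 mulr1 mul1r.
  rewrite power_moment1// shift0// /moment_ratio big_ord1 expr1 /= ?add0r.
  by field; rewrite gt_eqF//; move: bl l0 => ? ?; lra.
have b1l : - 2^-1 - l < b + 1 by lra.
split; first by have [] := IH b bl.
have cn0 : n.+1%:R + 2 * l != 0.
  rewrite gt_eqF//; have : 0 < n.+1%:R :> R by rewrite ltr0n.
  by move: l0 => ? ?; lra.
apply: (mulfI cn0); rewrite power_moment_rec//.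
have [-> ->] := IH b bl; have [_ ->] := IH _ b1l.
rewrite shift0// moment_ratio_shift// !moment_ratioS.
have E1 : n.+1%:R = n%:R + 1 :> R by rewrite natr1.
have -> : s ^+ n.+2 = s ^+ n by rewrite -addn2 exprD s1 mulr1.
rewrite exprS.
have pos (m : nat) : m%:R + b + 2 * l + 1 != 0.
  by rewrite gt_eqF//; have := ler0n R m; move: bl l0 => ? ? ?; lra.
have := pos n; have := pos n.+1; have := pos 0; rewrite E1 => p0 p1 pn.
transitivity (s ^+ n * power_moment s b 0 * moment_ratio b n *
  (s ^+ 2 * (2 * (n%:R + 1 + l)) * ((n%:R - b) / (n%:R + b + 2 * l + 1)
    - (2 * b + 2 * l + 1) * (- b - 1) / ((n%:R + b + 2 * l + 1) * (n%:R + 1 + b + 2 * l + 1)))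
   - (n%:R + 1))).
  by field; rewrite p1 pn; rewrite add0r in p0; rewrite p0.
rewrite s1.
by field; rewrite p1 pn.
Qed.

Lemma power_moment_opp b : - 2^-1 - l < b ->
  power_moment (-1) b 0 = power_moment 1 b 0.
Proof.
move=> bl; have bm := min_gt bl.
have wb := weight_bounded_moment 0 (weight_bounded_powR b (expr1n R 2)).
rewrite /power_moment /moment -(integral_opp _ wb); last by lra.
by apply: eq_Rintegral => t _; rewrite sqrrN mulrN mulNr !hornerC.
Qed.

Lemma power_moment_gt0 b : - 2^-1 - l < b -> 0 < power_moment 1 b 0.
Proof.
move=> bl; have bm := min_gt bl.
have wb := weight_bounded_moment 0 (weight_bounded_powR b (expr1n R 2)).
apply: (weight_bounded_gt0 _ wb); first by lra.
move=> t tb; rewrite hornerC mulr1 mulr_gt0 ?powR_gt0 ?subr_sqr_gt0//.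
by have /andP[] := affine_bounds (expr1n R 2) tb.
Qed.

End Fixed.
End Moments.

(** * Asymptotics of the moments of powers *)

Section RatioAsymptotics.
Context {R : realType}.
Implicit Types (b l q e x y C : R) (n m : nat).

Lemma ln_sub_bounds x y : 0 < x -> 0 < y ->
  (x - y) / x <= ln x - ln y <= (x - y) / y.
Proof.
have up (u v : R) : 0 < u -> 0 < v -> ln u - ln v <= (u - v) / v.
  move=> u0 v0; rewrite -ln_div ?posrE//.
  have uv0 : 0 < u / v by rewrite divr_gt0.
  have -> : (u - v) / v = u / v - 1 by field; rewrite gt_eqF.
  by rewrite -{1}[u / v](subrKC 1) le_ln1Dx//; lra.
move=> x0 y0; rewrite up// andbT -lerN2 opprB -mulNr opprB; exact: up.
Qed.

Lemma inv_sqr_series_cvg (C : R) (delta : R^nat) :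
  (forall n, `|delta n| <= C / n.+1%:R ^+ 2) -> cvgn (series delta).
Proof.
move=> dC; apply: normed_cvg.
have C0 : 0 <= C.
  by have := le_trans (normr_ge0 _) (dC 0%N); rewrite expr1n divr1.
have H n : \sum_(0 <= k < n) `|delta k| <= C *+ 2 - C *+ 2 / n.+1%:R.
  elim: n => [|n IH]; first by rewrite big_geq// divr1 subrr.
  rewrite big_nat_recr//=; apply: (le_trans (lerD IH (dC n))).
  have E1 : n.+2%:R = n.+1%:R + 1 :> R by rewrite natr1.
  have : 1 <= n.+1%:R :> R by rewrite ler1n.
  rewrite E1; move: (n.+1%:R : R) => x x1.
  have -> : C *+ 2 - C *+ 2 / x + C / x ^+ 2 =
            C *+ 2 - C *+ 2 / (x + 1) - C * (x - 1) / (x ^+ 2 * (x + 1)).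
    by field; apply/andP; split; rewrite gt_eqF//; lra.
  rewrite lerBlDr lerDl divr_ge0//; apply: mulr_ge0 => //; try lra.
    exact: sqr_ge0.
apply: nondecreasing_is_cvgn.
  by apply/nondecreasing_seqP => n; rewrite /normed_series_of seriesSr lerDl normr_ge0.
exists (C *+ 2) => _ [n _ <-]; rewrite /normed_series_of seriesEnat /=; apply: (le_trans (H n)).
by rewrite lerBlDr lerDl divr_ge0// mulrn_wge0.
Qed.

Lemma moment_ratio_nat l b n m : b = m%:R -> (m < n)%N -> moment_ratio l b n = 0.
Proof.
move=> -> mn; rewrite /moment_ratio (bigD1 (Ordinal mn)) //=.
by rewrite subrr !mul0r.
Qed.

(** Past an index [N] beyond which all factors are positive, the ratio of
    consecutive terms is [expR (delta j)]. Both logarithms in [delta j] are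
    [q / (N + j)], with opposite signs, up to an error of order
    [1 / j ^+ 2]. *)
Lemma moment_ratio_cvg l b : 0 <= l -> - 2^-1 - l < b -> b \isn't a Num.nat ->
  exists2 K, K != 0 & n%:R `^ (2 * b + 2 * l + 1) * moment_ratio l b n @[n --> \oo] --> K.
Proof.
move=> l0 bl bN; set q := 2 * b + 2 * l + 1.
pose e := b + 2 * l + 1; have e0 : 0 < e by rewrite /e; lra.
pose u n := n%:R `^ q * moment_ratio l b n.
pose B := `|b| + `|e|.
(* this choice keeps n - b and n + e above n / 2 for n >= N *)
pose N := (Num.truncn (2 * B)).+1.
pose delta j := q * (ln (N + j).+1%:R - ln (N + j)%:R)
  + (ln ((N + j)%:R - b) - ln ((N + j)%:R + e)).
have N2B j : 2 * B < (N + j)%:R.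
  apply: (lt_le_trans (Num.Theory.truncnS_gt _)).
  by rewrite ler_nat leq_addr.
have Npos j : 0 < (N + j)%:R :> R by rewrite ltr0n addSn.
have pos_b j : (N + j)%:R / 2 < (N + j)%:R - b.
  have := N2B j; have := ler_norm b; have := normr_ge0 e; rewrite /B; lra.
have pos_e j : (N + j)%:R / 2 < (N + j)%:R + e.
  have := Npos j; lra.
have uS j : u (N + j).+1 = u (N + j)%N * expR (delta j).
  have n0 := Npos j; have h1 := pos_b j; have h2 := pos_e j.
  have E1 : expR (q * (ln (N + j).+1%:R - ln (N + j)%:R)) =
            (N + j).+1%:R `^ q / (N + j)%:R `^ q.
    by rewrite mulrBr expRB -!ln_powR !lnK// posrE powR_gt0.
  have E2 : expR (ln ((N + j)%:R - b) - ln ((N + j)%:R + e)) =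
            ((N + j)%:R - b) / ((N + j)%:R + e).
    by rewrite expRB !lnK// posrE; lra.
  rewrite /u moment_ratioS /delta expRD E1 E2.
  have -> : (N + j)%:R + b + 2 * l + 1 = (N + j)%:R + e by rewrite /e; ring.
  have p0 : (N + j)%:R `^ q != 0 by rewrite gt_eqF// powR_gt0.
  by field; rewrite p0 gt_eqF//; lra.
have uE k : u (N + k)%N = u N * expR (series delta k).
  elim: k => [|k IH]; first by rewrite addn0 seriesEnat/= big_geq// expR0 mulr1.
  by rewrite addnS uS IH seriesSr (expRD (series delta k)) mulrA.
have cdelta : cvgn (series delta).
  apply: (@inv_sqr_series_cvg (`|q| * (1 + 2 * B))) => j.
  have n0 := Npos j; have h1 := pos_b j; have h2 := pos_e j.
  have nj : j.+1%:R <= (N + j)%:R :> R by rewrite ler_nat addSn ltnS leq_addl.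
  have B0 : 0 <= B by rewrite addr_ge0.
  apply: (@le_trans _ _ (`|q| * (1 + 2 * B) / (N + j)%:R ^+ 2)); last first.
    apply: ler_wpM2l; first by rewrite mulr_ge0//; lra.
    by rewrite lef_pV2 ?posrE ?exprn_gt0// ler_pXn2r ?nnegrE// ltW.
  have : (N + j).+1%:R = (N + j)%:R + 1 :> R by rewrite natr1.
  rewrite /delta => ->; move: ((N + j)%:R : R) n0 h1 h2 => x x0 h1 h2.
  have /andP[a1 a2] := ln_sub_bounds (ltr_wpDr ler01 x0) x0.
  have xb0 : 0 < x - b by lra.
  have xe0 : 0 < x + e by lra.
  have /andP[b1 b2] := ln_sub_bounds xb0 xe0.
  set L1 := ln (x + 1) - ln x in a1 a2 *; set L2 := ln (x - b) - ln (x + e) in b1 b2 *.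
  have -> : q * L1 + L2 = q * (L1 - x^-1) + (L2 + q / x) by ring.
  apply: (le_trans (ler_normD _ _)); rewrite normrM.
  have L1x : `|L1 - x^-1| <= (x ^+ 2)^-1.
    have E : (x + 1 - x) / (x + 1) - x^-1 = - (x * (x + 1))^-1.
      by field; apply/andP; split; rewrite gt_eqF//; lra.
    have E' : (x + 1 - x) / x = x^-1 by field; rewrite gt_eqF.
    have xx : (x * (x + 1))^-1 <= (x ^+ 2)^-1.
      by rewrite lef_pV2 ?posrE ?exprn_gt0// ?mulr_gt0//; [nra|lra].
    have x2 : 0 <= (x ^+ 2)^-1 by rewrite invr_ge0 sqr_ge0.
    rewrite E' in a2; rewrite ler_norml; apply/andP; split; last first.
      by apply: le_trans x2; rewrite subr_le0.
    by apply: (@le_trans _ _ (- (x * (x + 1))^-1)); rewrite ?lerN2// -E lerD2r.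
  have qe : q = b + e by rewrite /q /e; ring.
  have small c y : x / 2 < y -> `|q * c / (x * y)| <= `|q| * (2 * `|c|) / x ^+ 2.
    move=> xy; have y0 : 0 < y by lra.
    rewrite !normrM normfV normrM (gtr0_norm x0) (gtr0_norm y0) -!mulrA ler_wpM2l//.
    rewrite mulrCA ler_wpM2l// [leRHS](_ : _ = (x * (x / 2))^-1); last by field; rewrite gt_eqF.
    by rewrite lef_pV2 ?posrE ?mulr_gt0 ?divr_gt0// ler_pM2l// ltW.
  have L2q : `|L2 + q / x| <= `|q| * (2 * B) / x ^+ 2.
    have lo : - (q * b / (x * (x - b))) <= L2 + q / x.
      have <- : (x - b - (x + e)) / (x - b) + q / x = - (q * b / (x * (x - b))).
        by rewrite qe; field; apply/andP; split; rewrite gt_eqF.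
      by rewrite lerD2r.
    have hi : L2 + q / x <= q * e / (x * (x + e)).
      have <- : (x - b - (x + e)) / (x + e) + q / x = q * e / (x * (x + e)).
        by rewrite qe; field; apply/andP; split; rewrite gt_eqF.
      by rewrite lerD2r.
    have := small b _ h1; have := small e _ h2.
    have w : 0 <= `|q| / x ^+ 2 by rewrite divr_ge0// sqr_ge0.
    have wb : 0 <= `|q| / x ^+ 2 * `|b| by rewrite mulr_ge0.
    have we : 0 <= `|q| / x ^+ 2 * `|e| by rewrite mulr_ge0.
    have -> : `|q| * (2 * B) / x ^+ 2 = 2 * (`|q| / x ^+ 2 * `|b|) + 2 * (`|q| / x ^+ 2 * `|e|).
      by rewrite /B; ring.
    have -> : `|q| * (2 * `|b|) / x ^+ 2 = 2 * (`|q| / x ^+ 2 * `|b|) by ring.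
    have -> : `|q| * (2 * `|e|) / x ^+ 2 = 2 * (`|q| / x ^+ 2 * `|e|) by ring.
    rewrite !ler_norml => /andP[? ?] /andP[? ?].
    by apply/andP; split; lra.
  rewrite mulrDr mulr1 mulrDl; apply: lerD => //.
  by rewrite ler_wpM2l.
have uN : u N != 0.
  rewrite /u mulf_neq0//; first by rewrite gt_eqF// powR_gt0// ltr0n.
  rewrite /moment_ratio.
  apply/prodf_neq0 => j _; rewrite mulf_neq0 ?invr_eq0//.
    by apply: contraNneq bN => /eqP; rewrite subr_eq0 => /eqP <-; exact: natr_nat.
  by rewrite gt_eqF//; have := ler0n R j; lra.
exists (u N * expR (limn (series delta))).
  by rewrite mulf_neq0// gt_eqF// expR_gt0.
rewrite -(cvg_shiftn N).
apply: (@cvg_trans _ ((fun k => u N * expR (series delta k)) @ \oo)).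
  by apply: near_eq_cvg; near=> k; rewrite -uE addnC.
apply: cvgMr; apply: continuous_cvg; first exact: continuous_expR.
exact: cdelta.
Unshelve. all: end_near. Qed.

End RatioAsymptotics.

(** * Decay of the moments of smooth functions *)

Section SmoothDecay.
Context {R : realType}.
Notation mu := (@lebesgue_measure R).
Implicit Types (f g h : R -> R) (a b t l : R) (n k N : nat) (p : {poly R}).

Lemma weight_bounded_horner p : weight_bounded 0 (horner p).
Proof.
elim/poly_ind: p => [|p c IH].
  by apply: weight_bounded0P => [t _|]; [exact: continuous_horner|exists 0 => t _; rewrite horner0 normr0].
have -> : horner (p * 'X + c%:P) = (fun t => p.[t] * t + c).
  by apply/funext => t; rewrite !hornerE.
apply: weight_boundedD.
  apply: weight_boundedM => //; apply: weight_bounded0P => [t _|]; first exact: cvg_id.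
  by exists 1 => t /andP[? ?]; rewrite ler_norml; apply/andP; split; exact: ltW.
by apply: weight_bounded0P => [t _|]; [exact: cvg_cst|exists `|c|].
Qed.

(** [k] times differentiable on ]-1, 1[ with bounded continuous derivatives,
    in a recursive form that makes closure under products an induction. *)
Fixpoint bounded_smooth k f : Prop :=
  weight_bounded 0 f /\
  if k is k'.+1 then exists2 f' : R -> R,
    (forall t, -1 < t < 1 -> is_derive t 1 f (f' t)) & bounded_smooth k' f'
  else True.

Lemma bounded_smooth_wb k f : bounded_smooth k f -> weight_bounded 0 f.
Proof. by case: k => [|k] []. Qed.

Lemma bounded_smoothW k f : bounded_smooth k.+1 f -> bounded_smooth k f.
Proof.
elim: k f => [|k IH] f [hf [f' df hf']]; first by [].
by split=> //; exists f' => //; exact: IH.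
Qed.

Lemma bounded_smoothD k f g : bounded_smooth k f -> bounded_smooth k g ->
  bounded_smooth k (fun t => f t + g t).
Proof.
elim: k f g => [|k IH] f g [hf Hf] [hg Hg]; split; try exact: weight_boundedD.
  by [].
case: Hf Hg => f' df hf' [g' dg hg']; exists (fun t => f' t + g' t); last exact: IH.
by move=> t tb; have ? := df t tb; have ? := dg t tb; apply: is_derive_eq.
Qed.

Lemma bounded_smoothM k f g : bounded_smooth k f -> bounded_smooth k g ->
  bounded_smooth k (fun t => f t * g t).
Proof.
elim: k f g => [|k IH] f g Hf Hg; split; try exact: weight_boundedM (bounded_smooth_wb Hf) (bounded_smooth_wb Hg).
  by [].
have [_ [f' df hf']] := Hf; have [_ [g' dg hg']] := Hg.
exists (fun t => f t * g' t + g t * f' t).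
  by move=> t tb; have ? := df t tb; have ? := dg t tb; apply: is_derive_eq.
by apply: bounded_smoothD; apply: IH => //; exact: bounded_smoothW.
Qed.

Lemma bounded_smooth_horner k p : bounded_smooth k (horner p).
Proof.
elim: k p => [|k IH] p; split; try exact: weight_bounded_horner.
  by [].
by exists (horner p^`()%R) => // t _; exact: is_derive_poly.
Qed.

Section Fixed.
Variables (l : R) (l0 : 0 <= l).
Local Notation P := (ultraspherical l).

(** Green's formula: [(1 - t ^+ 2) `^ (l + 1/2) (f P' - f' P)] vanishes at both
    end points, and its derivative is the difference of the two integrands. *)
Lemma moment_laplacian f f' f'' n : weight_bounded 0 f -> weight_bounded 0 f' ->
  weight_bounded 0 f'' ->
  (forall t, -1 < t < 1 -> is_derive t 1 f (f' t)) ->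
  (forall t, -1 < t < 1 -> is_derive t 1 f' (f'' t)) ->
  n%:R * (n%:R + 2 * l) * moment l f n =
  moment l (fun t => ('X ^+ 2 - 1).[t] * f'' t + ((2 * l + 1) *: 'X).[t] * f' t) n.
Proof.
move=> hf hf' hf'' df df'; set nu := _ * (_ + _).
have l0' := l0; have bl : - 2^-1 - l < 0 by lra.
have lm : - 2^-1 < l by lra.
set L := (fun t => _ + _).
have hL : weight_bounded 0 L.
  by apply: weight_boundedD; apply: weight_boundedM => //; exact: weight_bounded_horner.
suff : moment l (fun t => L t + - nu * f t) n = 0.
  rewrite (momentD l0 _ bl)//; last exact: weight_boundedZ.
  by rewrite (momentZ l0 _ _ bl)// mulNr => /eqP; rewrite subr_eq0 => /eqP.
pose G t := (f t * (P n)^`().[t] - f' t * (P n).[t]) * (1 - t ^+ 2) `^ (l + 2^-1).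
have hg : weight_bounded 0 (fun t => f t * (P n)^`().[t] + -1 * (f' t * (P n).[t])).
  by apply: weight_boundedD; [|apply: weight_boundedZ]; apply: weight_boundedM => //;
    exact: weight_bounded_horner.
have [C C0 hC] := weight_bounded0_bound hg.
apply: (@weight_bounded_FTC _ (0 + (l - 2^-1)) (l + 2^-1) _ G C).
- by lra.
- by apply: weight_bounded_moment => //; apply: weight_boundedD => //; exact: weight_boundedZ.
- by lra.
- move=> t tb; have d0 := df t tb; have d1 := df' t tb.
  have d2 := is_derive_weight (l + 2^-1) tb.
  have d3 := is_derive_poly (P n) t; have d4 := is_derive_poly (P n)^`() t.
  apply: is_derive_eq; rewrite -![_ *: _]/(_ * _) /L !hornerE /=.
  have -> : l + 2^-1 - 1 = l - 2^-1 by lra.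
  have -> : (1 - t ^+ 2) `^ (l + 2^-1) = (1 - t ^+ 2) * (1 - t ^+ 2) `^ (l - 2^-1).
    have t2 := subr_sqr_gt0 tb.
    rewrite -[X in X * _](powRr1 (ltW t2)) -powRD; last first.
      by apply/implyP => _; rewrite gt_eqF.
    by congr (_ `^ _); lra.
  have ode := ultraspherical_ode lm n tb.
  move: (_ `^ (l - _)) => W.
  transitivity (W * (f t * ((1 - t ^+ 2) * (P n)^`()^`().[t])
    - (1 - t ^+ 2) * f'' t * (P n).[t]
    - (2 * l + 1) * t * (f t * (P n)^`().[t] - f' t * (P n).[t]))).
    by field.
  by rewrite ode /nu; ring.
- move=> t tb; rewrite normrM (@ger0_norm _ (_ `^ _)) ?powR_ge0//.
  by rewrite ler_wpM2r ?powR_ge0// -[X in _ - X]mul1r -mulNr hC.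
Qed.

Lemma moment_bounded f : weight_bounded 0 f -> exists C, forall n, `|moment l f n| <= C.
Proof.
move=> hf; have [C C0 hC] := weight_bounded0_bound hf.
have l0' := l0; have bl : - 2^-1 - l < 0 by lra.
have mI : measurable (`]-1, 1[%classic : set (measurableTypeR R)) by exact: measurable_itv.
have h1 : weight_bounded 0 (fun t => C * 1).
  by apply: weight_bounded0P => [t _|]; [exact: cvg_cst|exists `|C * 1|].
exists (moment l (fun t => C * 1) 0) => n.
have ifn := moment_integrable l0 n bl hf.
apply: (le_trans (le_normr_Rintegral mI ifn)).
apply: (le_Rintegral mI).
- exact: (integrable_norm ifn).
- exact: moment_integrable bl h1.
- move=> t /=; rewrite in_itv/= => tb.
  rewrite !normrM (@ger0_norm _ (_ `^ _)) ?powR_ge0// ler_wpM2r ?powR_ge0//.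
  rewrite hornerC mulr1 ler_pM ?hC// ultraspherical_bounded//; first by lra.
  by move: tb => /andP[? ?]; apply/andP; split; exact: ltW.
Qed.

Lemma moment_decay N f : bounded_smooth N.*2 f ->
  exists C, forall n, `|moment l f n.+1| <= C / n.+1%:R ^+ N.*2.
Proof.
elim: N f => [|N IH] f.
  move=> /bounded_smooth_wb/moment_bounded [C hC]; exists C => n.
  by rewrite expr0 divr1.
rewrite doubleS => -[hf [f' df [hf' [f'' df' Hf'']]]].
have hf'' := bounded_smooth_wb Hf''.
have Hf' : bounded_smooth N.*2 f' by apply: bounded_smoothW; split=> //; exists f''.
have [|C hC] := IH (fun t => ('X ^+ 2 - 1).[t] * f'' t + ((2 * l + 1) *: 'X).[t] * f' t).
  by apply: bounded_smoothD; apply: bounded_smoothM => //; exact: bounded_smooth_horner.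
exists C => n; have := moment_laplacian n.+1 hf hf' hf'' df df'.
have l0' := l0; have n0 : 0 < n.+1%:R :> R by rewrite ltr0n.
have nl : 0 < n.+1%:R + 2 * l by lra.
move=> /(congr1 Num.norm); rewrite normrM (gtr0_norm (mulr_gt0 n0 nl)) => E.
have := hC n; rewrite -E => h.
rewrite !exprSr -mulrA invfM mulrA ler_pdivlMr ?mulr_gt0// mulrC.
apply: le_trans h; rewrite ler_wpM2r// ler_pM2l//; lra.
Qed.

End Fixed.
End SmoothDecay.

(** * The remainder of the two expansions *)

Section Remainder.
Context {R : realType}.
Implicit Types (f : R -> R) (a b s t x : R) (i j k m n : nat).

Definition powR_derivn s b k : R := \prod_(i < k) (- s * (b - i%:R)).

Lemma powR_derivnS s b k :
  powR_derivn s b k.+1 = powR_derivn s b k * (- s * (b - k%:R)).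
Proof. by rewrite /powR_derivn big_ord_recr. Qed.

Lemma near_open_itv t : -1 < t < 1 -> \forall x \near t, -1 < x < 1.
Proof.
move=> tb; have : t \in `]-1, 1[ by rewrite in_itv.
by move/near_in_itvoo; apply: filterS => x; rewrite in_itv.
Qed.

Lemma derive1n_powR_affine s b k t : s ^+ 2 = 1 -> -1 < t < 1 ->
  derive1n k (fun x => (1 - s * x) `^ b) t = powR_derivn s b k * (1 - s * t) `^ (b - k%:R) /\
  is_derive t 1 (derive1n k (fun x => (1 - s * x) `^ b))
    (powR_derivn s b k.+1 * (1 - s * t) `^ (b - k.+1%:R)).
Proof.
move=> s1; elim: k t => [|k IH] t tb.
  have /andP[t0 _] := affine_bounds s1 tb.
  rewrite /powR_derivn big_ord0 big_ord1 derive1n0 subr0 mul1r; split=> //.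
  exact: is_derive_powR_affine.
have [_ dk] := IH t tb.
have E : derive1n k.+1 (fun x => (1 - s * x) `^ b) t =
    powR_derivn s b k.+1 * (1 - s * t) `^ (b - k.+1%:R).
  by rewrite derive1nS derive1E derive_val.
split=> //.
have /andP[t0 _] := affine_bounds s1 tb.
have := is_derive_powR_affine (b - k.+1%:R) t0.
move=> /(@is_deriveZ _ _ _ _ (powR_derivn s b k.+1)) d.
apply: (@near_eq_is_derive _ _ _
  (fun x => powR_derivn s b k.+1 * (1 - s * x) `^ (b - k.+1%:R))); last 1 first.
- move: d => /is_derive_eq; apply; rewrite (powR_derivnS s b k.+1).
  have -> : b - k.+2%:R = b - k.+1%:R - 1 by rewrite -[in LHS]natr1; ring.
  by rewrite -[_ *: _]/(_ * _) !mulrA.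
- apply: filterS (near_open_itv tb) => x xb.
  by have [_ dx] := IH x xb; rewrite derive1nS derive1E derive_val.
Qed.

Lemma bounded_smooth_sequence k (G : nat -> R -> R) :
  (forall j t, -1 < t < 1 -> is_derive t 1 (G j) (G j.+1 t)) ->
  (forall j, (j <= k)%N -> exists C, forall t, -1 < t < 1 -> `|G j t| <= C) ->
  bounded_smooth k (G 0%N).
Proof.
elim: k G => [|k IH] G dG bG; split=> //.
- by apply: weight_bounded0P => [t tb|]; [exact: derive_continuous (dG 0%N t tb)|exact: bG].
- by apply: weight_bounded0P => [t tb|]; [exact: derive_continuous (dG 0%N t tb)|exact: bG].
exists (G 1%N); first exact: dG.
by apply: (IH (fun j => G j.+1) (fun j => dG j.+1)) => j jk; exact: bG.
Qed.

Lemma bounded_open_itv (g : R -> R) :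
  (forall t, -1 < t < 1 -> {for t, continuous g}) ->
  (exists C, \forall t \near (-1)^'+, `|g t| <= C) ->
  (exists C, \forall t \near 1^'-, `|g t| <= C) ->
  exists C, forall t, -1 < t < 1 -> `|g t| <= C.
Proof.
move=> cg [C1 [e1 /= e10 h1]] [C2 [e2 /= e20 h2]].
pose e := Num.min (2^-1) (Num.min (e1 / 2) (e2 / 2)).
have e0 : 0 < e by rewrite !lt_min; apply/and3P; split; lra.
have [em1 em2 em3] : [/\ e <= 2^-1, e <= e1 / 2 & e <= e2 / 2].
  by rewrite /e !ge_min !lexx ?orbT.
have ab : -1 + e <= 1 - e by lra.
have cn : {within `[(-1 + e), (1 - e)], continuous (fun t => `|g t|)}.
  apply: continuous_in_subspaceT => t; rewrite inE/= in_itv/= => /andP[t1 t2].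
  apply: continuous_comp; last exact: norm_continuous.
  by apply: cg; apply/andP; split; lra.
have [c _ hc] := EVT_max ab cn.
exists (Num.max `|g c| (Num.max C1 C2)) => t /andP[t1 t2]; rewrite !le_max.
have [te|te] := ltP t (-1 + e).
  apply/orP; right; apply/orP; left; apply: h1 => //=.
  by rewrite ler0_norm; lra.
have [te2|te2] := ltP (1 - e) t.
  apply/orP; right; apply/orP; right; apply: h2 => //=.
  by rewrite ger0_norm; lra.
by apply/orP; left; apply: hc; rewrite in_itv/= te te2.
Qed.

Lemma powR_le_norm (x a : R) : 1 <= x <= 2 -> x `^ a <= 2 `^ `|a|.
Proof.
move=> /andP[x1 x2]; apply: (@le_trans _ _ (x `^ `|a|)).
  by apply: ler_powR => //; exact: ler_norm.
by apply: ge0_ler_powR; rewrite ?nnegrE//; lra.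
Qed.

Definition power_sum (c a : R^nat) s m k t : R :=
  \sum_(i < m) c i * derive1n k (fun x => (1 - s * x) `^ a i) t.

Lemma is_derive_power_sum (c a : R^nat) s m k t : s ^+ 2 = 1 -> -1 < t < 1 ->
  is_derive t 1 (power_sum c a s m k) (power_sum c a s m k.+1 t).
Proof.
move=> s1 tb; rewrite /power_sum; elim: m => [|m IH].
  rewrite big_ord0 (_ : (fun _ => _) = cst 0); first exact: is_derive_cst.
  by apply/funext => x; rewrite big_ord0.
rewrite big_ord_recr /=.
have -> : (fun x => \sum_(i < m.+1) c i * derive1n k (fun y => (1 - s * y) `^ a i) x) =
  (fun x => \sum_(i < m) c i * derive1n k (fun y => (1 - s * y) `^ a i) x
          + c m * derive1n k (fun y => (1 - s * y) `^ a m) x).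
  by apply/funext => x; rewrite big_ord_recr.
have [_ dm] := derive1n_powR_affine (a m) k s1 tb.
have [/= -> _] := derive1n_powR_affine (a m) k.+1 s1 tb.
by apply: is_derive_eq.
Qed.

(** On the half of the interval away from the singular end point [t = s], the
    base [1 - s t] stays in [1, 2]. *)
Lemma power_sum_bounded (c a : R^nat) s m k : s ^+ 2 = 1 ->
  exists C, forall t, -1 < t < 1 -> s * t <= 0 -> `|power_sum c a s m k t| <= C.
Proof.
move=> s1; exists (\sum_(i < m) `|c i * powR_derivn s (a i) k| * 2 `^ `|a i - k%:R|).
move=> t tb st; apply: (le_trans (ler_norm_sum _ _ _)); apply: ler_sum => i _.
have [-> _] := derive1n_powR_affine (a i) k s1 tb.
rewrite mulrA normrM ler_wpM2l// ger0_norm ?powR_ge0//.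
apply: powR_le_norm; have /andP[_ t2] := affine_bounds s1 tb.
by apply/andP; split; lra.
Qed.

Variables (f : R -> R) (A B alpha beta : R^nat).
Hypothesis hsmooth : smooth_on_interval f.
Hypothesis hleft : expansion_left f A alpha.
Hypothesis hright : expansion_right f B beta.
Hypothesis hleft_deriv : forall k : nat, (1 <= k)%N -> derived_expansion_left k f A alpha.
Hypothesis hright_deriv : forall k : nat, (1 <= k)%N -> derived_expansion_right k f B beta.

Let affineN (a : R) : (fun x : R => (1 + x) `^ a) = (fun x => (1 - -1 * x) `^ a).
Proof. by apply/funext => x; rewrite mulN1r opprK. Qed.

Let affine1 (a : R) : (fun x : R => (1 - x) `^ a) = (fun x => (1 - 1 * x) `^ a).
Proof. by apply/funext => x; rewrite mul1r. Qed.

Let power_sum_left (c a : R^nat) m k t : power_sum c a (-1) m k t =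
  \sum_(i < m) c i * derive1n k (fun x => (1 + x) `^ a i) t.
Proof. by apply: eq_bigr => i _; rewrite (affineN (a i)). Qed.

(** The expansion of the [k]-th derivative has an error term
    [O((1 + t) `^ (alpha m.+1 - k))], whose exponent is nonnegative. *)
Let left_bounded m k : k%:R <= alpha m.+1 ->
  exists C, \forall t \near (-1)^'+,
    `|derive1n k f t - power_sum A alpha (-1) m.+1 k t| <= C.
Proof.
move=> km.
have [C C0 H] : exists2 C, 0 < C & \forall t \near (-1)^'+,
    `|derive1n k f t - power_sum A alpha (-1) m.+1 k t| <= C * `|(1 + t) `^ (alpha m.+1 - k%:R)|.
  case: k km => [|k] km.
    have /eqO_exP [C C0 H] := hleft m.
    exists C; first exact: C0.
    by apply: filterS H => t; rewrite power_sum_left subr0; apply.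
  have /eqO_exP [C C0 H] := @hleft_deriv k.+1 isT m.
  exists C; first exact: C0.
  by apply: filterS H => t; rewrite power_sum_left; apply.
exists C; near=> t; apply: (@le_trans _ _ (C * `|(1 + t) `^ (alpha m.+1 - k%:R)|)).
  by near: t.
have t1 : -1 < t by near: t; exact: nbhs_right_gt.
have t0 : t <= 0 by near: t; apply: nbhs_right_le; rewrite oppr_lt0.
rewrite ler_piMr ?(ltW C0)// ger0_norm ?powR_ge0//.
apply: (@le_trans _ _ (1 `^ (alpha m.+1 - k%:R))); last by rewrite powR1.
by apply: ge0_ler_powR; rewrite ?nnegrE//; lra.
Unshelve. all: end_near. Qed.

Let power_sum_right (c a : R^nat) m k t : power_sum c a 1 m k t =
  \sum_(i < m) c i * derive1n k (fun x => (1 - x) `^ a i) t.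
Proof. by apply: eq_bigr => i _; rewrite (affine1 (a i)). Qed.

Let right_bounded m k : k%:R <= beta m.+1 ->
  exists C, \forall t \near 1^'-,
    `|derive1n k f t - power_sum B beta 1 m.+1 k t| <= C.
Proof.
move=> km.
have [C C0 H] : exists2 C, 0 < C & \forall t \near 1^'-,
    `|derive1n k f t - power_sum B beta 1 m.+1 k t| <= C * `|(1 - t) `^ (beta m.+1 - k%:R)|.
  case: k km => [|k] km.
    have /eqO_exP [C C0 H] := hright m.
    exists C; first exact: C0.
    by apply: filterS H => t; rewrite power_sum_right subr0; apply.
  have /eqO_exP [C C0 H] := @hright_deriv k.+1 isT m.
  exists C; first exact: C0.
  by apply: filterS H => t; rewrite power_sum_right; apply.
exists C; near=> t; apply: (@le_trans _ _ (C * `|(1 - t) `^ (beta m.+1 - k%:R)|)).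
  by near: t.
have t1 : t < 1 by near: t; exact: nbhs_left_lt.
have t0 : 0 <= t by near: t; apply: nbhs_left_ge.
rewrite ler_piMr ?(ltW C0)// ger0_norm ?powR_ge0//.
apply: (@le_trans _ _ (1 `^ (beta m.+1 - k%:R))); last by rewrite powR1.
by apply: ge0_ler_powR; rewrite ?nnegrE//; lra.
Unshelve. all: end_near. Qed.

Lemma remainder_bounded_smooth m k : k%:R <= alpha m.+1 -> k%:R <= beta m.+1 ->
  bounded_smooth k (fun t => f t - power_sum A alpha (-1) m.+1 0 t
                                 - power_sum B beta 1 m.+1 0 t).
Proof.
move=> ka kb.
have sN : (-1) ^+ 2 = 1 :> R by rewrite sqrrN expr1n.
have s1 : 1 ^+ 2 = 1 :> R by rewrite expr1n.
pose G j t := derive1n j f t - power_sum A alpha (-1) m.+1 j t - power_sum B beta 1 m.+1 j t.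
have dG j t : -1 < t < 1 -> is_derive t 1 (G j) (G j.+1 t).
  move=> tb; have d1 := is_derive_power_sum A alpha m.+1 j sN tb.
  have d2 := is_derive_power_sum B beta m.+1 j s1 tb.
  have d0 : is_derive t 1 (derive1n j f) (derive1n j.+1 f t).
    by rewrite derive1nS derive1E; apply: derivableP; apply: hsmooth; rewrite in_itv.
  by rewrite /G; apply: is_derive_eq.
apply: (@bounded_smooth_sequence k G) => // j jk.
have jk' : j%:R <= k%:R :> R by rewrite ler_nat.
apply: bounded_open_itv.
- by move=> t tb; exact: derive_continuous (dG j t tb).
- have [C HC] := left_bounded (le_trans jk' ka).
  have [D HD] := power_sum_bounded B beta m.+1 j s1.
  exists (C + D); near=> t; rewrite /G; apply: (le_trans (ler_normB _ _)).
  apply: lerD; first by near: t.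
  have t1 : -1 < t by near: t; exact: nbhs_right_gt.
  have t0 : t <= 0 by near: t; apply: nbhs_right_le; rewrite oppr_lt0.
  by apply: HD; [apply/andP; split; lra|rewrite mul1r].
- have [C HC] := right_bounded (le_trans jk' kb).
  have [D HD] := power_sum_bounded A alpha m.+1 j sN.
  exists (C + D); near=> t; rewrite /G addrAC; apply: (le_trans (ler_normB _ _)).
  apply: lerD; first by near: t.
  have t1 : t < 1 by near: t; exact: nbhs_left_lt.
  have t0 : 0 <= t by near: t; apply: nbhs_left_ge.
  by apply: HD; [apply/andP; split; lra|rewrite mulN1r oppr_le0].
Unshelve. all: end_near. Qed.

End Remainder.

(** * Asymptotics of the Legendre coefficients *)

Section CoefficientAsymptotics.
Context {R : realType}.
Implicit Types (f : R -> R) (A B alpha beta : R^nat) (l g a b q : R) (d i j k m n p : nat).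

Lemma natr_powR_cvg0 q : q < 0 -> n%:R `^ q @[n --> \oo] --> (0 : R).
Proof.
move=> q0; rewrite -(cvg_shiftS (fun n => n%:R `^ q)).
have q1 : 0 < - q by rewrite oppr_gt0.
have /cvg_at_rightP := @powR_cvg0 R _ q1 => /(_ (@harmonic R)) H.
apply: (@cvg_trans _ (@harmonic R n `^ (- q) @[n --> \oo])).
  apply: near_eq_cvg; near=> n; rewrite /harmonic /=.
  by rewrite -powR_inv1 -?powRrM ?mulN1r ?opprK.
by apply: H; split; [move=> n; exact: harmonic_gt0|exact: cvg_harmonic].
Unshelve. all: end_near. Qed.

Lemma bounded_cvg0M (u v : R^nat) (C : R) : (forall n, `|v n| <= C) ->
  u n @[n --> \oo] --> (0 : R) -> v n * u n @[n --> \oo] --> (0 : R).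
Proof.
move=> vC u0; have C0 : 0 <= C := le_trans (normr_ge0 _) (vC 0%N).
apply/cvgr0Pnorm_le => e e0; near=> n.
rewrite normrM; apply: (@le_trans _ _ ((C + 1) * (e / (C + 1)))); last first.
  by rewrite mulrC divfK// gt_eqF//; lra.
apply: ler_pM => //; first by apply: (le_trans (vC n)); rewrite lerDl.
near: n; move/cvgr0Pnorm_le : u0; apply.
by rewrite divr_gt0//; lra.
Unshelve. all: end_near. Qed.

Lemma bin_cvg p : exists2 c : R, 0 < c &
  'C(n + p, p)%:R / n.+1%:R ^+ p @[n --> \oo] --> c.
Proof.
elim: p => [|p [c c0 hc]].
  exists 1 => //; apply: cvg_near_cst; near=> n.
  by rewrite bin0 expr0 divr1.
exists (c * (1 / p.+1%:R)); first by rewrite mulr_gt0// divr_gt0.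
have h : (1 + p%:R * n.+1%:R^-1) / p.+1%:R @[n --> \oo] --> (1 / p.+1%:R : R).
  apply: cvgMl; rewrite -[X in _ --> X]addr0; apply: cvgD; first exact: cvg_cst.
  rewrite -[X in _ --> X](mulr0 p%:R); apply: cvgMr; exact: cvg_harmonic.
apply: cvg_trans (cvgM hc h); apply: near_eq_cvg; near=> n.
have E : 'C(n + p.+1, p.+1)%:R = (n + p.+1)%:R * 'C(n + p, p)%:R / p.+1%:R :> R.
  apply: (@mulfI _ p.+1%:R); first by rewrite pnatr_eq0.
  by rewrite -!natrM -mul_bin_diag addnS /= natrM mulrCA divff ?mulr1 ?pnatr_eq0// natrM.
rewrite /= E exprS natrD.
have -> : n%:R + p.+1%:R = n.+1%:R + p%:R :> R by rewrite -!natrD addnS.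
have : p.+1%:R != 0 :> R by rewrite pnatr_eq0.
have : n.+1%:R ^+ p != 0 :> R by rewrite expf_neq0// pnatr_eq0.
have : n.+1%:R != 0 :> R by rewrite pnatr_eq0.
move: (n.+1%:R : R) (p.+1%:R : R) => x y x0 xp y0.
by field; rewrite y0 x0 xp.
Unshelve. all: end_near. Qed.

Lemma harmonic_dim_cvg d : (2 <= d)%N -> exists2 c : R, 0 < c &
  harmonic_dim d n / n%:R ^+ (d - 2) @[n --> \oo] --> c.
Proof.
move=> d2; have [p ->] : exists p, d = p.+2 by exists (d - 2)%N; rewrite -addn2 subnK.
have [c c0 hc] := bin_cvg p; exists (2 * c); first by rewrite mulr_gt0.
rewrite -(cvg_shiftS (fun n => harmonic_dim p.+2 n / n%:R ^+ (p.+2 - 2))).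
have h : 2 + p%:R * n.+1%:R^-1 @[n --> \oo] --> (2 : R).
  rewrite -[X in _ --> X]addr0; apply: cvgD; first exact: cvg_cst.
  by rewrite -[X in _ --> X](mulr0 p%:R); apply: cvgMr; exact: cvg_harmonic.
apply: cvg_trans (cvgM h hc); apply: near_eq_cvg; near=> n.
rewrite /= /harmonic_dim /=.
have -> : (p.+2 - 2)%N = p by rewrite -addn2 addnK.
have -> : (n.+1 + p.+2 - 3)%N = (n + p)%N by rewrite addSn !addnS !subSS subn0.
have -> : (n.+1 - 1)%N = n by rewrite subn1.
have -> : 'C(n + p, n) = 'C(n + p, p) by rewrite -[in RHS]bin_sub ?leq_addl// addnK.
have -> : (2 * n.+1 + p.+2 - 2)%N = (2 * n.+1 + p)%N by rewrite !addnS -addn2 addnK.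
rewrite natrD natrM mulrA; congr (_ / _); congr (_ * _).
have : n.+1%:R != 0 :> R by rewrite pnatr_eq0.
by move: (n.+1%:R : R) => x x0; field.
Unshelve. all: end_near. Qed.

Lemma power_coef_cvg l a g (K : R) : 0 <= l -> - 2^-1 - l < a -> a \is a Num.nat \/ g <= a ->
  n%:R `^ (2 * g + 2 * l + 1) * moment_ratio l g n @[n --> \oo] --> K -> g \isn't a Num.nat ->
  n%:R `^ (2 * g + 2 * l + 1) * moment_ratio l a n @[n --> \oo] --> (a == g)%:R * K.
Proof.
move=> l0 al ag hK gN; have [->|ng] := eqVneq a g; first by rewrite mul1r.
rewrite mul0r; have [aN|aN] := boolP (a \is a Num.nat).
  have /natrP [m ea] := aN.
  apply: cvg_near_cst; near=> n; rewrite (@moment_ratio_nat _ _ _ _ m) ?mulr0//.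
  by near: n; exact: nbhs_infty_gt.
have {}ag : g < a by case: ag => [|ga]; [rewrite (negbTE aN)|rewrite lt_neqAle eq_sym ng].
have [Ka _ hKa] := moment_ratio_cvg l0 al aN.
have h0 : n%:R `^ (2 * (g - a)) @[n --> \oo] --> (0 : R) by apply: natr_powR_cvg0; lra.
rewrite -[X in _ --> X](mul0r Ka); apply: cvg_trans (cvgM h0 hKa).
apply: near_eq_cvg; near=> n.
have n0 : n%:R != 0 :> R by rewrite pnatr_eq0 -lt0n; near: n; exact: nbhs_infty_gt.
rewrite /= mulrA -powRD ?n0 ?implybT//; congr (_ `^ _ * _); ring.
Unshelve. all: end_near. Qed.

Lemma power_sum_moment l (c a : R^nat) s m n b : 0 <= l -> s ^+ 2 = 1 ->
  - 2^-1 - l < b -> b <= 0 -> (forall i, b <= a i) ->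
  weight_bounded b (power_sum c a s m 0) /\
  moment l (power_sum c a s m 0) n =
    s ^+ n * \sum_(i < m) c i * (power_moment l 1 (a i) 0 * moment_ratio l (a i) n).
Proof.
move=> l0 s1 bl b0 ba; elim: m => [|m [wm IH]].
  have -> : power_sum c a s 0 0 = (fun t => 0 * cst 1 t).
    by apply/funext => t; rewrite /power_sum big_ord0 mul0r.
  have w0 : weight_bounded b (fun t : R => 0 * cst 1 t : R).
    apply: (weight_boundedW b0); apply: weight_boundedZ; apply: weight_bounded0P => [t _|].
      exact: cvg_cst.
    by exists 1 => t _; rewrite normr1.
  split=> //; rewrite big_ord0 mulr0 /moment.
  under eq_Rintegral do rewrite mul0r !mul0r.
  by rewrite Rintegral_cst//= mul0r.
have wa : weight_bounded b (fun t => (1 - s * t) `^ a m).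
  apply: weight_boundedW (weight_bounded_powR (a m) s1).
  by rewrite le_min ba b0.
have wca := weight_boundedZ (c m) wa.
have E : power_sum c a s m.+1 0 = (fun t => power_sum c a s m 0 t + c m * (1 - s * t) `^ a m).
  by apply/funext => t; rewrite /power_sum big_ord_recr.
rewrite E; split; first exact: weight_boundedD.
rewrite (momentD l0 n bl wm wca) (momentZ l0 _ n bl wa) IH big_ord_recr /= mulrDr.
have al : - 2^-1 - l < a m := lt_le_trans bl (ba m).
rewrite -/(power_moment l s (a m) n) (power_momentE l0 n s1 al).
congr (_ + _).
have -> : power_moment l s (a m) 0 = power_moment l 1 (a m) 0.
  move: s1 => /eqP; rewrite sqrf_eq1 => /orP[/eqP ->|/eqP ->]; first reflexivity.
  exact: power_moment_opp.
by ring.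
Qed.

Lemma cvg_sum_ord m (F : nat -> R^nat) (L : R^nat) :
  (forall i, F i n @[n --> \oo] --> L i) ->
  \sum_(i < m) F i n @[n --> \oo] --> \sum_(i < m) L i.
Proof.
move=> FL; elim: m => [|m IH].
  by rewrite big_ord0; apply: cvg_near_cst; near=> n; rewrite big_ord0.
rewrite big_ord_recr /=; apply: cvg_trans (cvgD IH (FL m)).
by apply: near_eq_cvg; near=> n; rewrite big_ord_recr.
Unshelve. all: end_near. Qed.

Lemma incr_homo (a : R^nat) : (forall i, a i < a i.+1) ->
  {homo a : i j / (i < j)%N >-> i < j}.
Proof. by move=> incr; apply: homo_ltn => //; exact: lt_trans. Qed.

Lemma incr_inj (a : R^nat) : (forall i, a i < a i.+1) -> injective a.
Proof.
move=> /incr_homo incr i j aij; apply/eqP.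
by have [/incr|/incr|//] := ltngtP i j; rewrite aij ltxx.
Qed.

(** [v] is the coefficient of the power of exponent [g] (0 when [g] is not an
    exponent), and no power of non-natural exponent below [g] occurs. *)
Definition leading_term (c a : R^nat) g (v : R) :=
  [/\ forall i, a i \is a Num.nat \/ c i = 0 \/ g <= a i,
      forall i, a i = g -> c i = v
    & (forall i, a i <> g) -> v = 0].

(** After scaling by [n `^ (2 g + 2 l + 1)], only the term of exponent [g]
    survives: larger exponents decay faster, natural ones contribute nothing
    for large [n]. *)
Lemma power_sum_cvg l (c a : R^nat) g v m (K : R) : 0 <= l ->
  (forall i, - 2^-1 - l < a i) -> (forall i, a i < a i.+1) -> g < a m ->
  g \isn't a Num.nat -> leading_term c a g v ->
  n%:R `^ (2 * g + 2 * l + 1) * moment_ratio l g n @[n --> \oo] --> K ->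
  \sum_(i < m) c i * (power_moment l 1 (a i) 0 *
     (n%:R `^ (2 * g + 2 * l + 1) * moment_ratio l (a i) n)) @[n --> \oo] -->
  v * (power_moment l 1 g 0 * K).
Proof.
move=> l0 al incr gm gN [sp1 sp2 sp3] hK.
have term i : c i * (power_moment l 1 (a i) 0 *
     (n%:R `^ (2 * g + 2 * l + 1) * moment_ratio l (a i) n)) @[n --> \oo] -->
   c i * (power_moment l 1 (a i) 0 * ((a i == g)%:R * K)).
  have [ci0|ci0] := eqVneq (c i) 0.
    by apply: cvg_near_cst; near=> n; rewrite ci0 !mul0r.
  apply: cvgMr; apply: cvgMr; apply: power_coef_cvg => //.
  by have [|[/eqP|]] := sp1 i; [left|rewrite (negbTE ci0)|right].
have sumE : \sum_(i < m) c i * (power_moment l 1 (a i) 0 * ((a i == g)%:R * K)) =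
   v * (power_moment l 1 g 0 * K).
  have [[j aj]|nj] := pselect (exists j, a j = g).
    have jm : (j < m)%N.
      rewrite ltnNge; apply/negP; rewrite leq_eqVlt => /predU1P[mj|/(incr_homo incr)].
        by move: gm; rewrite mj aj ltxx.
      by rewrite aj ltNge ltW.
    rewrite (bigD1 (Ordinal jm))//= big1 => [|i ij]; last first.
      rewrite (_ : a i == g = false) ?mul0r ?mulr0//; apply/negbTE.
      apply: contraNneq ij => ai; apply/eqP/val_inj => /=; by apply: (incr_inj incr); rewrite ai aj.
    by rewrite addr0 aj eqxx mul1r (sp2 j aj).
  rewrite sp3 ?mul0r; last by move=> i ai; apply: nj; exists i.
  apply: big1 => i _; rewrite (_ : a i == g = false) ?mul0r ?mulr0//.
  by apply/negbTE/eqP => ai; apply: nj; exists i.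
rewrite -sumE.
exact: (@cvg_sum_ord m _ (fun i => c i * (power_moment l 1 (a i) 0 * ((a i == g)%:R * K))) term).
Unshelve. all: end_near. Qed.

Lemma legendre_coefE d f n : (2 <= d)%N ->
  legendre_coef d f n = harmonic_dim d n * (sphere_area d.-1 / sphere_area d) *
    moment (d%:R / 2 - 1) f n.
Proof.
move=> d2; rewrite /legendre_coef mulrA; congr (_ * _).
have -> : (d%:R - 3) / 2 = d%:R / 2 - 1 - 2^-1 :> R by field.
by apply: eq_Rintegral => t _; rewrite legendreE.
Qed.

Lemma expansion_moment d f A B alpha beta N m : (2 <= d)%N ->
  smooth_on_interval f -> admissible_expansion d A alpha ->
  admissible_expansion d B beta ->
  expansion_left f A alpha -> expansion_right f B beta ->
  (forall k, (1 <= k)%N -> derived_expansion_left k f A alpha) ->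
  (forall k, (1 <= k)%N -> derived_expansion_right k f B beta) ->
  N.*2%:R <= alpha m.+1 -> N.*2%:R <= beta m.+1 ->
  let l : R := d%:R / 2 - 1 in
  exists C, forall n, `|moment l f n.+1 -
      ((-1) ^+ n.+1 * \sum_(i < m.+1) A i * (power_moment l 1 (alpha i) 0 * moment_ratio l (alpha i) n.+1)
       + \sum_(i < m.+1) B i * (power_moment l 1 (beta i) 0 * moment_ratio l (beta i) n.+1))|
    <= C / n.+1%:R ^+ N.*2.
Proof.
move=> d2 sm [a0 ai _ _] [b0 bi _ _] hl hr hdl hdr am bm l.
have d2' : 2 <= d%:R :> R by rewrite (ler_nat _ 2).
have l0 : 0 <= l by rewrite /l; lra.
have lE : - 2^-1 - l = (1 - d%:R) / 2 by rewrite /l; field.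
pose c := Num.min (Num.min (alpha 0%N) (beta 0%N)) 0.
have cl : - 2^-1 - l < c by rewrite !lt_min lE a0 b0 -lE; lra.
have c0 : c <= 0 by rewrite ge_min lexx orbT.
have ca i : c <= alpha i.
  by case: i => [|i]; rewrite /c !ge_min ?lexx// (ltW (incr_homo ai (ltn0Sn i))).
have cb i : c <= beta i.
  by case: i => [|i]; rewrite /c !ge_min ?lexx ?(ltW (incr_homo bi (ltn0Sn i))) ?orbT.
have sN : (-1) ^+ 2 = 1 :> R by rewrite sqrrN expr1n.
have s1 : 1 ^+ 2 = 1 :> R by rewrite expr1n.
have Hg := remainder_bounded_smooth sm hl hr hdl hdr am bm.
set g := (fun t => _ - _) in Hg.
have [C HC] := moment_decay l0 Hg.
exists C => n; apply: le_trans (HC n); rewrite le_eqVlt; apply/orP; left; apply/eqP; congr `|_|.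
have [wA mA] := power_sum_moment A m.+1 n.+1 l0 sN cl c0 ca.
have [wB mB] := power_sum_moment B m.+1 n.+1 l0 s1 cl c0 cb.
rewrite expr1n mul1r in mB.
have wg : weight_bounded c g := weight_boundedW c0 (bounded_smooth_wb Hg).
have -> : moment l f n.+1 = moment l (fun t => g t + (power_sum A alpha (-1) m.+1 0 t + power_sum B beta 1 m.+1 0 t)) n.+1.
  by apply: eq_moment => t _; rewrite /g; ring.
rewrite (momentD l0 _ cl wg) ?(momentD l0 _ cl wA wB) ?mA ?mB ?addrK//.
exact: weight_boundedD.
Qed.

(** The order [N.*2] of the remainder estimate is chosen so that the decay
    [n ^- N.*2] beats the scaling, and so that the truncated expansions contain
    the exponent [g] if it occurs at all. *)
Lemma legendre_coef_asymp d f A B alpha beta g a b : (2 <= d)%N ->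
  smooth_on_interval f -> admissible_expansion d A alpha ->
  admissible_expansion d B beta ->
  expansion_left f A alpha -> expansion_right f B beta ->
  (forall k, (1 <= k)%N -> derived_expansion_left k f A alpha) ->
  (forall k, (1 <= k)%N -> derived_expansion_right k f B beta) ->
  (1 - d%:R) / 2 < g -> g \isn't a Num.nat ->
  leading_term A alpha g a -> leading_term B beta g b ->
  exists2 E, E != 0 & n%:R `^ (2 * g + 1) * legendre_coef d f n
    - E * ((-1) ^+ n * a + b) @[n --> \oo] --> (0 : R).
Proof.
move=> d2 sm hA hB hl hr hdl hdr gd gN spa spb.
have [a0 ai ainf _] := hA; have [b0 bi binf _] := hB.
pose l : R := d%:R / 2 - 1.
have d2' : 2 <= d%:R :> R by rewrite (ler_nat _ 2).
have l0 : 0 <= l by rewrite /l; lra.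
have lE : - 2^-1 - l = (1 - d%:R) / 2 by rewrite /l; field.
have gl : - 2^-1 - l < g by rewrite lE.
have ca i : - 2^-1 - l < alpha i.
  by rewrite lE; case: i => // i; apply: (lt_trans a0); exact: incr_homo.
have cb i : - 2^-1 - l < beta i.
  by rewrite lE; case: i => // i; apply: (lt_trans b0); exact: incr_homo.
pose q := 2 * g + 2 * l + 1.
pose N := (Num.truncn (`|q| + `|g|)).+1.
have Nqg : `|q| + `|g| < N.*2%:R.
  apply: (lt_le_trans (Num.Theory.truncnS_gt _)).
  by rewrite ler_nat -addnn leq_addr.
have qN : q < N.*2%:R by have := ler_norm q; have := normr_ge0 g; lra.
have gN2 : g < N.*2%:R by have := ler_norm g; have := normr_ge0 q; lra.
have [m [am bm]] : exists m, N.*2%:R <= alpha m.+1 /\ N.*2%:R <= beta m.+1.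
  have /cvgryPge/(_ N.*2%:R) [m1 _ h1] := ainf.
  have /cvgryPge/(_ N.*2%:R) [m2 _ h2] := binf.
  exists (maxn m1 m2); split; [apply: h1|apply: h2] => /=.
    by rewrite leqW// leq_maxl.
  by rewrite leqW// leq_maxr.
have [C HC] := expansion_moment d2 sm hA hB hl hr hdl hdr am bm.
have [K K0 hK] := moment_ratio_cvg l0 gl gN.
have [kap kap0 hkap] := @harmonic_dim_cvg d d2.
pose J := power_moment l 1 g 0.
have J0 : 0 < J by exact: power_moment_gt0.
pose sig : R := sphere_area d.-1 / sphere_area d.
have sig0 : 0 < sig.
  by rewrite divr_gt0// sphere_area_gt0//; case: (d) d2 => [|[]].
exists (sig * kap * (J * K)); first
  exact: (mulf_neq0 (mulf_neq0 (lt0r_neq0 sig0) (lt0r_neq0 kap0))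
    (mulf_neq0 (lt0r_neq0 J0) K0)).
pose T (c u : R^nat) n : R := \sum_(i < m.+1) c i * (power_moment l 1 (u i) 0 *
  (n%:R `^ q * moment_ratio l (u i) n)).
have cvT (c u : R^nat) v : (forall i, - 2^-1 - l < u i) -> (forall i, u i < u i.+1) ->
    g < u m.+1 -> leading_term c u g v ->
    T c u n.+1 - v * (J * K) @[n --> \oo] --> (0 : R).
  move=> cu ui um spu.
  have := power_sum_cvg l0 cu ui um gN spu hK.
  rewrite -(cvg_shiftS (fun n => \sum_(i < _) _)) => h.
  rewrite -[X in _ --> X](subrr (v * (J * K))).
  by apply: cvgB; [exact: h|exact: cvg_cst].
have hA' := cvT _ _ _ ca ai (lt_le_trans gN2 am) spa.
have hB' := cvT _ _ _ cb bi (lt_le_trans gN2 bm) spb.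
pose z n : R := (-1) ^+ n.+1 * (a * (J * K)) + b * (J * K).
have zb n : `|z n| <= `|a * (J * K)| + `|b * (J * K)|.
  apply: (le_trans (ler_normD _ _)); rewrite lerD2r normrM normrX normrN1 expr1n.
  by rewrite mul1r.
pose y n := n.+1%:R `^ q * moment l f n.+1.
pose rest n := n.+1%:R `^ q * (moment l f n.+1 - ((-1) ^+ n.+1 *
  \sum_(i < m.+1) A i * (power_moment l 1 (alpha i) 0 * moment_ratio l (alpha i) n.+1)
  + \sum_(i < m.+1) B i * (power_moment l 1 (beta i) 0 * moment_ratio l (beta i) n.+1))).
have rest0 : rest n @[n --> \oo] --> (0 : R).
  have h0 : C * n.+1%:R `^ (q - N.*2%:R) @[n --> \oo] --> (0 : R).
    rewrite -[X in _ --> X](mulr0 C); apply: cvgMr.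
    have qN0 : q - N.*2%:R < 0 by lra.
    by have := natr_powR_cvg0 qN0; rewrite -(cvg_shiftS (fun n => n%:R `^ _)).
  apply/cvgr0Pnorm_le => e e0; near=> n.
  apply: (@le_trans _ _ `|C * n.+1%:R `^ (q - N.*2%:R)|); last first.
    by near: n; move/cvgr0Pnorm_le : h0; apply.
  apply: (le_trans _ (ler_norm _)).
  rewrite /rest normrM (ger0_norm (powR_ge0 _ _)).
  rewrite powRB ?pnatr_eq0 ?implybT// powR_mulrn// mulrCA.
  by rewrite ler_wpM2l ?powR_ge0.
have TE (c u : R^nat) n : n.+1%:R `^ q * (\sum_(i < m.+1) c i * (power_moment l 1 (u i) 0 * moment_ratio l (u i) n.+1))
    = T c u n.+1.
  by rewrite /T mulr_sumr; apply: eq_bigr => i _; ring.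
have yz : y n - z n @[n --> \oo] --> (0 : R).
  have h : rest n + ((-1) ^+ n.+1 * (T A alpha n.+1 - a * (J * K)) +
      (T B beta n.+1 - b * (J * K))) @[n --> \oo] --> (0 : R).
    rewrite -[X in _ --> X](addr0 0); apply: cvgD; first exact: rest0.
    rewrite -[X in _ --> X](addr0 0); apply: cvgD; last exact: hB'.
    apply: (@bounded_cvg0M _ (fun n => (-1) ^+ n.+1) 1); last exact: hA'.
    by move=> n; rewrite normrX normrN1 expr1n.
  apply: cvg_trans h; apply: near_eq_cvg; near=> n.
  by rewrite /y /z /rest -!TE; ring.
pose x n := harmonic_dim d n.+1 / n.+1%:R ^+ (d - 2) : R.
have hx : x n @[n --> \oo] --> kap.
  by move: hkap; rewrite -(cvg_shiftS (fun n => harmonic_dim d n / _)).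
have hx0 : x n - kap @[n --> \oo] --> (0 : R).
  by rewrite -[X in _ --> X](subrr kap); apply: cvgB; [exact: hx|exact: cvg_cst].
rewrite -(cvg_shiftS (fun n => n%:R `^ _ * legendre_coef d f n - _)).
have h : sig * (x n * (y n - z n) + z n * (x n - kap)) @[n --> \oo] --> (0 : R).
  rewrite -[X in _ --> X](mulr0 sig); apply: cvgMr.
  rewrite -[X in _ --> X](addr0 0); apply: cvgD.
    by rewrite -[X in _ --> X](mulr0 kap); apply: cvgM.
  exact: bounded_cvg0M zb hx0.
apply: cvg_trans h; apply: near_eq_cvg; near=> n.
rewrite /= legendre_coefE// -/l -/sig /x /y /z.
have n0 : n.+1%:R != 0 :> R by rewrite pnatr_eq0.
have -> : n.+1%:R `^ q = n.+1%:R `^ (2 * g + 1) * n.+1%:R ^+ (d - 2).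
  rewrite -powR_mulrn// -powRD ?n0 ?implybT//; congr (_ `^ _).
  by rewrite natrB// /q /l; field.
have nd : n.+1%:R ^+ (d - 2) != 0 :> R by rewrite expf_neq0.
move: (_ `^ _) (n.+1%:R ^+ (d - 2)) nd => W V V0.
by field.
Unshelve. all: end_near. Qed.

End CoefficientAsymptotics.

(** * The three cases *)

Section Subsequences.
Context {R : realType}.
Implicit Types (A B alpha beta u v : R^nat) (g a b c : R) (d i j k n p : nat).

Lemma leading_term0 A alpha g : g \isn't a Num.nat ->
  (g%:E < sing_exponent A alpha)%E -> leading_term A alpha g 0.
Proof.
move=> gN gs.
have H i : alpha i \isn't a Num.nat -> A i != 0 -> g < alpha i.
  move=> iN Ai; rewrite -lte_fin; apply: (lt_le_trans gs).
  by apply: ereal_inf_lbound; exists i.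
split=> [i|i ig|//].
  have [|iN] := boolP (alpha i \is a Num.nat); first by left.
  by have [->|Ai] := eqVneq (A i) 0; right; [left|right; exact/ltW/H].
apply/eqP; apply/negPn/negP => Ai.
by have := H i; rewrite ig ltxx => /(_ gN Ai).
Qed.

Lemma sing_exponent_leading d A alpha j : admissible_expansion d A alpha ->
  sing_exponent A alpha = (alpha j)%:E ->
  [/\ alpha j \isn't a Num.nat, A j != 0 & leading_term A alpha (alpha j) (A j)].
Proof.
move=> hA sj; have [_ incr _ _] := hA.
have ex : exists i, alpha i \isn't a Num.nat /\ A i != 0.
  apply/not_existsP => H.
  suff : sing_exponent A alpha = +oo%E by rewrite sj.
  rewrite /sing_exponent (_ : [set _ | _ in _] = set0) ?ereal_inf0//.
  by apply/seteqP; split=> // x [i Hi _]; exact: (H i).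
have [i [iN Ai si ile]] := sing_exponent_attained hA ex.
have ij : i = j by apply: (incr_inj incr); move: si; rewrite sj => -[].
rewrite -ij; split=> //; split=> [i'|i' /(incr_inj incr) -> //|H].
  have [|i'N] := boolP (alpha i' \is a Num.nat); first by left.
  by have [->|Ai'] := eqVneq (A i') 0; right; [left|right; exact: ile].
by have := H i.
Qed.

Lemma sing_exponent_cases d A alpha : admissible_expansion d A alpha ->
  sing_exponent A alpha = +oo%E \/ exists j, sing_exponent A alpha = (alpha j)%:E.
Proof.
move=> hA.
have [ex|nex] := pselect (exists i, alpha i \isn't a Num.nat /\ A i != 0).
  by have [i [_ _ si _]] := sing_exponent_attained hA ex; right; exists i.
left; rewrite /sing_exponent (_ : [set _ | _ in _] = set0) ?ereal_inf0//.
by apply/seteqP; split=> // x [i Hi _]; apply: nex; exists i.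
Qed.

Lemma subsequence_cvg (n_ : nat -> nat) u : {homo n_ : i j / (i < j)%N} ->
  u n @[n --> \oo] --> (0 : R) -> u (n_ k) @[k --> \oo] --> (0 : R).
Proof.
move=> incr u0; have le_n k : (k <= n_ k)%N.
  by elim: k => // k IH; apply: (leq_ltn_trans IH); exact: incr.
apply: (cvg_comp _ _ _ u0) => P [N _ NP].
by exists N => // k /= Nk; apply: NP => /=; exact: leq_trans (le_n k).
Qed.

(** Along the subsequence the alternating limit takes at most two values, both
    nonzero, so that dividing by it preserves the null difference. *)
Lemma alternating_asymp g (b_ : R^nat) (E : R) a b (n_ : nat -> nat) (c : bool -> R) :
  {homo n_ : i j / (i < j)%N} ->
  n%:R `^ (2 * g + 1) * b_ n - E * ((-1) ^+ n * a + b) @[n --> \oo] --> (0 : R) ->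
  (forall e, 0 < c e) ->
  (forall k, `|E * ((-1) ^+ n_ k * a + b)| = c (odd (n_ k))) ->
  asymp_equiv (fun k => `|b_ (n_ k)|)
    (fun k => c (odd (n_ k)) * (n_ k)%:R `^ (- 2 * g - 1)).
Proof.
move=> incr h c0 hc; have := subsequence_cvg incr h.
have posn k : (0 < k)%N -> (0 < n_ k)%N.
  by move=> /incr; apply: leq_ltn_trans.
move=> hk; rewrite /asymp_equiv.
pose u k := (n_ k)%:R `^ (2 * g + 1) * b_ (n_ k).
pose v k := E * ((-1) ^+ n_ k * a + b).
have d0 : `|u k| - `|v k| @[k --> \oo] --> (0 : R).
  apply/cvgr0Pnorm_le => e e0; near=> k.
  apply: (le_trans (ler_dist_dist _ _)).
  by near: k; move/cvgr0Pnorm_le : hk; apply.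
have [M M0 hM] : exists2 M, 0 <= M & forall e, (c e)^-1 <= M.
  exists ((c true)^-1 + (c false)^-1); first by rewrite addr_ge0 ?invr_ge0 ?ltW.
  by case; rewrite ?lerDl ?lerDr invr_ge0 ltW.
have h1 : (c (odd (n_ k)))^-1 * (`|u k| - `|v k|) @[k --> \oo] --> (0 : R).
  apply: (@bounded_cvg0M _ _ (fun k => (c (odd (n_ k)))^-1) M); last exact: d0.
  by move=> k; rewrite ger0_norm ?invr_ge0 ?(ltW (c0 _)).
have h2 : 1 + (c (odd (n_ k)))^-1 * (`|u k| - `|v k|) @[k --> \oo] --> (1 : R).
  by rewrite -[X in _ --> X]addr0; apply: cvgD; [exact: cvg_cst|exact: h1].
apply: cvg_trans h2; apply: near_eq_cvg; near=> k.
have n0 : 0 < (n_ k)%:R :> R.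
  by rewrite ltr0n; apply: posn; near: k; exact: nbhs_infty_gt.
rewrite /= /v hc /u normrM ger0_norm ?powR_ge0//.
have -> : - 2 * g - 1 = - (2 * g + 1) by ring.
rewrite powRN; have W0 : (n_ k)%:R `^ (2 * g + 1) != 0 by rewrite gt_eqF// powR_gt0.
have c1 : c (odd (n_ k)) != 0 by rewrite gt_eqF.
move: (_ `^ _) (c _) W0 c1 => W C W0 C0.
by field; rewrite W0 C0.
Unshelve. all: end_near. Qed.

Lemma alternating_littleo g (b_ : R^nat) (E : R) a b (n_ : nat -> nat) :
  {homo n_ : i j / (i < j)%N} ->
  n%:R `^ (2 * g + 1) * b_ n - E * ((-1) ^+ n * a + b) @[n --> \oo] --> (0 : R) ->
  (forall k, (-1) ^+ n_ k * a + b = 0) ->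
  (fun k => `|b_ (n_ k)|) =o_\oo (fun k => (n_ k)%:R `^ (- 2 * g - 1)).
Proof.
move=> incr h hk0; have hk := subsequence_cvg incr h.
have posn k : (0 < k)%N -> (0 < n_ k)%N.
  by move=> /incr; apply: leq_ltn_trans.
apply/eqoP => e e0; near=> k.
have n0 : 0 < (n_ k)%:R :> R.
  by rewrite ltr0n; apply: posn; near: k; exact: nbhs_infty_gt.
have : `|(n_ k)%:R `^ (2 * g + 1) * b_ (n_ k) - E * ((-1) ^+ n_ k * a + b)| <= e.
  by near: k; move/cvgr0Pnorm_le : hk; apply.
rewrite hk0 mulr0 subr0 normrM (ger0_norm (powR_ge0 _ _)) normr_id.
have -> : - 2 * g - 1 = - (2 * g + 1) by ring.
rewrite (ger0_norm (powR_ge0 _ _)) powRN ler_pdivlMr ?powR_gt0//.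
by rewrite mulrC.
Unshelve. all: end_near. Qed.

Lemma half_not_nat p : p%:R + 2^-1 \isn't a @Num.nat R.
Proof.
apply/negP => /natrP [m E].
have : (p.*2.+1)%:R = m.*2%:R :> R.
  by rewrite -!mul2n -natr1 !natrM -E; field.
by move/eqP; rewrite eqr_nat => /eqP/(congr1 odd); rewrite oddS !odd_double.
Qed.

End Subsequences.

Theorem theorem3p7 (R : realType) (d : nat) (f : R -> R)
    (A B alpha beta : nat -> R) (hd : (2 <= d)%N)
    (hsmooth : smooth_on_interval f)
    (hA : admissible_expansion d A alpha)
    (hB : admissible_expansion d B beta)
    (hleft : expansion_left f A alpha)
    (hright : expansion_right f B beta)
    (hleft_deriv : forall k : nat, (1 <= k)%N ->
       derived_expansion_left k f A alpha)
    (hright_deriv : forall k : nat, (1 <= k)%N ->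
       derived_expansion_right k f B beta) :
  let gamma_alpha : \bar R := sing_exponent A alpha in
  let gamma_beta : \bar R := sing_exponent B beta in
  let gamma : \bar R := Order.min gamma_alpha gamma_beta in
  let b : nat -> R := legendre_coef d f in
  let rate : nat -> R := fun n => n%:R `^ (- 2 * fine gamma - 1) in
  [/\ gamma = +oo%E ->
        forall p : nat, n%:R ^+ p * b n @[n --> \oo] --> (0 : R),
      gamma_alpha <> gamma_beta ->
        exists2 c : R, 0 < c &
          asymp_equiv (fun n => `|b n|) (fun n => c * rate n)
    & gamma_alpha = gamma_beta -> (gamma < +oo)%E ->
        forall ja jb : nat,
        (alpha ja)%:E = gamma -> (beta jb)%:E = gamma ->
        (forall n_ : nat -> nat, {homo n_ : i j / (i < j)%N} ->
           (forall k, (-1) ^+ n_ k * A ja + B jb = 0) ->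
           (fun k => `|b (n_ k)|) =o_\oo (fun k => rate (n_ k)))
        /\
        (exists2 c : bool -> R, (forall e, 0 < c e) &
         forall n_ : nat -> nat, {homo n_ : i j / (i < j)%N} ->
           (forall k, (-1) ^+ n_ k * A ja + B jb != 0) ->
           asymp_equiv (fun k => `|b (n_ k)|)
                       (fun k => c (odd (n_ k)) * rate (n_ k)))].
Proof.
move=> ga gb gamma b rate.
have asymp g a' b' := @legendre_coef_asymp R d f A B alpha beta g a' b' hd hsmooth hA hB
  hleft hright hleft_deriv hright_deriv.
have above_a j : (1 - d%:R) / 2 < alpha j.
  by have [h0 hi _ _] := hA; case: j => // j; apply: (lt_trans h0); exact: incr_homo.
have above_b j : (1 - d%:R) / 2 < beta j.
  by have [h0 hi _ _] := hB; case: j => // j; apply: (lt_trans h0); exact: incr_homo.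
have single g a' b' : gamma = g%:E -> (1 - d%:R) / 2 < g -> g \isn't a Num.nat ->
    leading_term A alpha g a' -> leading_term B beta g b' ->
    (a' != 0) && (b' == 0) || (a' == 0) && (b' != 0) ->
    exists2 c : R, 0 < c & asymp_equiv (fun n => `|b n|) (fun n => c * rate n).
  move=> gE gd gN spa spb ab.
  have [E E0 hE] := asymp g a' b' gd gN spa spb.
  have ab0 : a' + b' != 0.
    by case/orP: ab => /andP[]; [move=> h /eqP ->; rewrite addr0|move=> /eqP -> h; rewrite add0r].
  have c0 : 0 < `|E * (a' + b')| by rewrite normr_gt0 mulf_neq0.
  exists `|E * (a' + b')| => //; rewrite /rate gE /=.
  apply: (@alternating_asymp _ g b E a' b' id (fun _ => `|E * (a' + b')|)) => // n.
  rewrite !normrM; congr (_ * _).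
  case/orP: ab => /andP[]; first by move=> _ /eqP ->; rewrite !addr0 normrM normrX normrN1 expr1n mul1r.
  by move=> /eqP -> _; rewrite mulr0.
split.
- move=> goo p.
  have lt_g s : (gamma <= s)%E -> forall g : R, (g%:E < s)%E.
    by rewrite goo leye_eq => /eqP -> g; exact: ltry.
  (* a non-natural exponent, so that no term can have it as an exponent *)
  pose g : R := p%:R + 2^-1.
  have gd : (1 - d%:R) / 2 < g.
    have : 2 <= d%:R :> R by rewrite (ler_nat _ 2).
    by have := ler0n R p; rewrite /g => ? ?; lra.
  have gN : g \isn't a Num.nat by exact: half_not_nat.
  have [||E _ hE] := asymp g 0 0 gd gN.
  + by apply: leading_term0 => //; apply: lt_g; rewrite ge_min lexx.
  + by apply: leading_term0 => //; apply: lt_g; rewrite ge_min lexx orbT.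
  have q0 : - (p + 2)%:R < 0 :> R by rewrite oppr_lt0 ltr0n addn2.
  rewrite -[X in _ --> X](mul0r 0); apply: cvg_trans (cvgM (natr_powR_cvg0 q0) hE).
  apply: near_eq_cvg; near=> n.
  have n0 : n%:R != 0 :> R by rewrite pnatr_eq0 -lt0n; near: n; exact: nbhs_infty_gt.
  rewrite /= mulr0 addr0 mulr0 subr0 mulrA -powRD ?n0 ?implybT//.
  rewrite -powR_mulrn//; congr (_ `^ _ * _).
  by rewrite /g natrD; field.
- move=> gab.
  have case_a j : ga = (alpha j)%:E -> (ga < gb)%E ->
    exists2 c : R, 0 < c & asymp_equiv (fun n => `|b n|) (fun n => c * rate n).
    move=> gaj lt_ab; have [gN Aj spa] := sing_exponent_leading hA gaj.
    apply: (single (alpha j) (A j) 0) => //; last by rewrite Aj eqxx.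
      by rewrite /gamma min_l ?gaj// -gaj ltW.
    by apply: leading_term0 => //; rewrite -gaj.
  have case_b j : gb = (beta j)%:E -> (gb < ga)%E ->
    exists2 c : R, 0 < c & asymp_equiv (fun n => `|b n|) (fun n => c * rate n).
    move=> gbj lt_ba; have [gN Bj spb] := sing_exponent_leading hB gbj.
    apply: (single (beta j) 0 (B j)) => //; last by rewrite Bj eqxx orbT.
      by rewrite /gamma min_r ?gbj// -gbj ltW.
    by apply: leading_term0 => //; rewrite -gbj.
  have /orP[lt_ab|lt_ba] : (ga < gb)%E || (gb < ga)%E.
      by rewrite -neq_lt; apply/eqP.
    have [gaoo|[j gaj]] := sing_exponent_cases hA; last exact: case_a gaj lt_ab.
    by move: lt_ab; rewrite /ga gaoo ltNge leey.
  have [gboo|[j gbj]] := sing_exponent_cases hB; last exact: case_b gbj lt_ba.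
  by move: lt_ba; rewrite /gb gboo ltNge leey.
- move=> gab glt ja jb ja_g jb_g.
  have gE : gamma = ga by rewrite /gamma -gab minxx.
  have gaj : sing_exponent A alpha = (alpha ja)%:E by rewrite ja_g gE.
  have gbj : sing_exponent B beta = (beta jb)%:E by rewrite jb_g gE.
  have jab : beta jb = alpha ja by apply: EFin_inj; rewrite ja_g jb_g.
  have [gN Aj spa] := sing_exponent_leading hA gaj.
  have [_ Bj spb] := sing_exponent_leading hB gbj; rewrite jab in spb.
  have [E E0 hE] := asymp _ _ _ (above_a ja) gN spa spb.
  rewrite /rate -ja_g /=; split=> [n_ incr hk|].
    exact: (@alternating_littleo _ (alpha ja) b E (A ja) (B jb)).
  pose w (e : bool) : R := E * ((-1) ^+ e * A ja + B jb).
  (* the value 1 is for a parity that no admissible subsequence meets *)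
  exists (fun e => if w e == 0 then 1 else `|w e|).
    by move=> e; case: ifPn => // we; rewrite normr_gt0.
  move=> n_ incr hk.
  apply: (@alternating_asymp _ (alpha ja) b E (A ja) (B jb) n_
    (fun e => if w e == 0 then 1 else `|w e|)) => // [e|k].
    by case: ifPn => // we; rewrite normr_gt0.
  rewrite /w signr_odd ifF//; apply/negbTE; rewrite mulf_neq0//.
Unshelve. all: end_near. Qed.
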